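(* Let $0<q<1$, let $a,b,c,d,r,t$ be complex parameters with $r\neq 0$, $t\neq 0$, let $\theta\in\mathbb{R}$, and assume that none of the denominators below vanishes. If $|t|<1$, then the Askey-Wilson polynomials $p_n(\cdot;a,b,c,d|q)$ satisfy $$ \sum_{n=0}^\infty \frac{(abcd;q)_{2n}\,p_n(\cos\theta;a,b,c,d|q)}{(q,ab,ac,bc,abcdq^{n-1};q)_n}\,\frac{(r/t,abc/r;q)_n}{(abcdt/r,rd;q)_n}\,t^n $$ $$ =\frac{(abcd,\,dt,\,abcte^{i\theta}/r,\,re^{i\theta};q)_\infty}{(abcdt/r,\,dr,\,abce^{i\theta},\,te^{i\theta};q)_\infty}\;{}_8W_7\big(abce^{i\theta}/q;\,ae^{i\theta},be^{i\theta},ce^{i\theta},r/t,abc/r;\,q,\,te^{-i\theta}\big). $$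
   Context: Notation: $(x;q)_k=\prod_{j=0}^{k-1}(1-xq^j)$ for $k\in\mathbb{Z}_{\ge0}\cup\{\infty\}$, and $(x_1,\dots,x_r;q)_k=\prod_i (x_i;q)_k$. The Askey-Wilson polynomials are $$p_n(\cos\theta;a,b,c,d|q)=a^{-n}(ab,ac,ad;q)_n\sum_{k=0}^n\frac{(q^{-n},abcdq^{n-1},ae^{i\theta},ae^{-i\theta};q)_k}{(q,ab,ac,ad;q)_k}q^k .$$ They are polynomials in $\cos\theta$ and in $a,b,c,d$, symmetric in $a,b,c,d$ (this is how the formula is read when $a=0$ or a denominator in it vanishes). The very-well-poised series is $${}_{8}W_7(a_1;a_4,\dots,a_8;q,z)=\sum_{k=0}^\infty\frac{1-a_1q^{2k}}{1-a_1}\,\frac{(a_1,a_4,\dots,a_8;q)_k}{(q,a_1q/a_4,\dots,a_1q/a_8;q)_k}\,z^k .$$ *)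

(* Defs.v *)
From mathcomp Require Import all_boot all_order all_algebra.
From mathcomp Require Import all_classical all_reals all_analysis.
From mathcomp Require Import complex.

Set Implicit Arguments.
Unset Strict Implicit.
Unset Printing Implicit Defensive.

Import Order.TTheory GRing.Theory Num.Theory.
Import numFieldNormedType.Exports.

Local Open Scope classical_set_scope.
Local Open Scope ring_scope.

(* R[i] carries no topology instance under its own name; seen as a
   numFieldType it inherits the one given by the modulus. *)
Definition Cplx (R : realType) : numFieldType := R[i]%C.

Definition ofR (R : realType) (x : R) : Cplx R := x%:C%C.

(* e^{i theta} *)
Definition expi (R : realType) (theta : R) : Cplx R :=
  (cos theta +i* sin theta)%C.

Section QSeries.
Variable C : numFieldType.
Implicit Types (q x z : C) (s : seq C) (ps : seq (C * C)).

Definition qpoch x q (k : nat) : C := \prod_(0 <= j < k) (1 - x * q ^+ j).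

Definition qpoch_inf x q : C := limn (qpoch x q).

Definition qpochs s q (k : nat) : C := \prod_(x <- s) qpoch x q k.

Definition qpochs_inf s q : C := \prod_(x <- s) qpoch_inf x q.

(* The defining formula of the Askey-Wilson polynomial p_n(x; a,b,c,d | q)
   at x = (z + z^-1) / 2. *)
Definition aw_formula q (n : nat) (z b c d a : C) : C :=
  a ^- n * qpochs [:: a * b; a * c; a * d] q n *
  \sum_(0 <= k < n.+1)
     qpochs [:: q ^- n; a * b * c * d * q ^ (n%:Z - 1); a * z; a / z] q k /
     qpochs [:: q; a * b; a * c; a * d] q k * q ^+ k.

(* p_n is a polynomial in a, so where the formula is undefined (a = 0, or
   ab, ac or ad in {q^-j | j < n}) its value is the limit of the formula at
   parameters a' -> a with a' != a. *)
Definition aw_at q (n : nat) (z a b c d : C) : C :=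
  if (a != 0) && (qpochs [:: a * b; a * c; a * d] q n != 0)
  then aw_formula q n z b c d a
  else lim (aw_formula q n z b c d a' @[a' --> a^']).

(* Very-well-poised 8W7.  Each upper parameter a_j (j = 4..8) comes in a pair
   (a_j, b_j), where b_j is only used when a_j = 0: there a_1 q / a_j has to be
   read after cancellation of the common factor of a_1 and a_j, and b_j is the
   cancelled value. *)
Definition wp_lower q (a1 : C) (p : C * C) : C :=
  if p.1 != 0 then a1 * q / p.1 else p.2.

Definition W87_den q (a1 : C) ps (k : nat) : C :=
  qpochs (q :: [seq wp_lower q a1 p | p <- ps]) q k.

Definition W87_term q (a1 : C) ps z (k : nat) : C :=
  (1 - a1 * q ^+ (2 * k)) / (1 - a1) *
  (qpochs (a1 :: [seq p.1 | p <- ps]) q k / W87_den q a1 ps k) * z ^+ k.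

Definition W87 q (a1 : C) (p4 p5 p6 p7 p8 : C * C) z : C :=
  limn (series (W87_term q a1 [:: p4; p5; p6; p7; p8] z)).

End QSeries.

(* p_n(cos theta; a,b,c,d | q) *)
Definition askey_wilson_cos (R : realType) (q : Cplx R) (n : nat) (theta : R)
    (a b c d : Cplx R) : Cplx R :=
  aw_at q n (expi theta) a b c d.

(* Main.v *)
Require Import Defs.
From mathcomp Require Import all_boot all_order all_algebra.
From mathcomp Require Import all_classical all_reals all_analysis.
From mathcomp Require Import complex ring zify.
Set Implicit Arguments.
Unset Strict Implicit.
Unset Printing Implicit Defensive.
Import Order.TTheory GRing.Theory Num.Theory.
Import numFieldNormedType.Exports.
Local Open Scope classical_set_scope.
Local Open Scope ring_scope.

(** Write X = abcd, e = e^(i theta) and w = abce.  By Watson's transformation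
([aw_formula_vwp]), p_n / (ab, ac, bc; q)_n is a terminating very-well-poised
series of base w/q,
  e^n sum_(k <= n) c_k e^(-2k)
    (q; q)_n (X q^(n-1); q)_k (d/e; q)_(n-k) / ((q; q)_(n-k) (w; q)_(n+k)),
where c_k is independent of n and d.  Insert this into the generating function
and put n = k + m.  The factor (X; q)_(2n) / (X q^(n-1); q)_n is
very-well-poised in n; multiplied by (X q^(n-1); q)_k it becomes (X; q)_(2k)
times a factor very-well-poised in m, of base X q^(2k-1) ([vwp_qpoch]).  For
fixed k the sum over m is therefore a 6W5 with numerator parameters r q^k / t,
abc q^k / r and d/e; its argument is te, precisely the value at which the 6W5 is
summable ([W65_sum]).  The resulting quotient of infinite products is the
one in the theorem times the factorials that complete c_k to the k-th term of
the 8W7 ([gf_double_row]).  Since all shifted factorials involved are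
bounded, and bounded away from 0 where they occur in denominators, the double
series is dominated by |t|^(k+m) and may be summed along diagonals or along rows
([gf_double_bdd], [series_diagonal]).

The two terminating sums needed for Watson's transformation and the 6W5 sum all
satisfy first-order recurrences, proved by telescoping with explicit partial
sums: in the length for the terminating ones, in z -> zq for the 6W5, where
iterating the recurrence produces the infinite products.

Where the defining formula of p_n breaks down, its value is a limit in a.  The
very-well-poised form stays continuous there, so the expansion of p_n holds for
all parameters ([aw_at_vwp]). *)

(** Dozens of shifted factorials in one goal make [field] very slow unless they
are variables; hypotheses about them must sit in the goal beforehand. *)
Ltac abstract_qpoch :=
  repeat match goal with
  | |- context [qpoch ?x ?y ?k] => move: (qpoch x y k) => ?
  end.

Ltac split_nonzero := repeat (apply/andP; split); assumption.

(** * Finite shifted factorials and the very-well-poised factor *)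

Section Algebra.
Variable F : numFieldType.
Implicit Types (x y z u q : F) (i j k m n : nat).

Lemma qpoch0 x q : qpoch x q 0 = 1.
Proof. by rewrite /qpoch big_geq. Qed.

Lemma qpochS x q k : qpoch x q k.+1 = qpoch x q k * (1 - x * q ^+ k).
Proof. by rewrite /qpoch big_nat_recr. Qed.

Lemma qpochSl x q k : qpoch x q k.+1 = (1 - x) * qpoch (x * q) q k.
Proof.
rewrite /qpoch big_nat_recl //= expr0 mulr1; congr (_ * _).
by apply: eq_bigr => i _; rewrite exprS mulrA.
Qed.

Lemma qpochD x q i j : qpoch x q (i + j) = qpoch x q i * qpoch (x * q ^+ i) q j.
Proof.
elim: j => [|j IH]; first by rewrite addn0 qpoch0 mulr1.
by rewrite addnS !qpochS IH -!mulrA -exprD.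
Qed.

Lemma qpoch_neq0S x q k : qpoch x q k.+1 != 0 ->
  (qpoch x q k != 0) /\ (1 - x * q ^+ k != 0).
Proof. by rewrite qpochS mulf_eq0 negb_or => /andP. Qed.

Lemma qpoch_neq0W x q k n : (k <= n)%N -> qpoch x q n != 0 -> qpoch x q k != 0.
Proof. by move=> /subnKC <-; rewrite qpochD mulf_eq0 negb_or => /andP[]. Qed.

Lemma qpoch_neq0_shift x q i j :
  qpoch x q (i + j) != 0 -> qpoch (x * q ^+ i) q j != 0.
Proof. by rewrite qpochD mulf_eq0 negb_or => /andP[]. Qed.

(** With A = x / q this is (1 - A q^(2k)) / (1 - A) times (A; q)_k, after
cancellation of 1 - A: it stays meaningful when A = 1, which the parameters of
the generating function allow. *)
Definition vwp x q k : F :=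
  if k is k'.+1 then (1 - x * q ^+ (k' + k')%N.+1) * qpoch x q k' else 1.

Lemma vwp0 x q : vwp x q 0 = 1. Proof. by []. Qed.

Lemma vwpS x q k : vwp x q k.+1 = (1 - x * q ^+ (k + k).+1) * qpoch x q k.
Proof. by []. Qed.

(** Shifting the summation index by j turns the very-well-poised factor of
base A into the one of base A q^(2j). Both exchanges of summation below rest
on this identity: it absorbs the one factor that depends on both indices. *)
Lemma vwp_qpoch x q j m : q != 0 ->
  vwp x q (j + m) * qpoch (x / q * q ^+ (j + m)) q j =
  qpoch x q (j + j) * vwp (x * q ^+ (j + j)) q m.
Proof.
move=> q0; case: j => [|j]; first by rewrite !qpoch0 expr0 !mulr1 mul1r.
have -> : (x / q * q ^+ (j.+1 + m)) = x * q ^+ (j + m).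
  by rewrite addSn exprS; field.
rewrite addSn vwpS -mulrA -qpochD; case: m => [|m].
  by rewrite vwp0 addn0 mulr1 mulrC -addnS -qpochS.
rewrite vwpS mulrCA -qpochD -mulrA -exprD.
congr (_ * _); last by congr qpoch; lia.
by congr (1 - _ * q ^+ _); lia.
Qed.

End Algebra.

(** * Two terminating summations *)

Section Sums.
Variable F : numFieldType.
Implicit Types (x y z u q : F) (i j k m n : nat).

(** A balanced terminating 3phi2. The parameters are chosen so that the sum is
(x, y; q)_k / (ux, uy; q)_k u^k, with no denominators other than those of the
summands. *)
Definition saalschutz_term q x y u k j : F :=
  qpoch (q ^- k) q j * qpoch (x * y * u / q * q ^+ k) q j * qpoch u q j /
  (qpoch q q j * qpoch (u * x) q j * qpoch (u * y) q j) * q ^+ j.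

(** Telescoping certificate for the first-order recurrence in k that the sum
and its closed form share. Multiplying by the denominators of the recurrence
keeps it valid for all parameters; the sum is then closed by (q^-k; q)_(k+1) =
0. *)
Lemma saalschutz_partial q x y u k j : q != 0 -> qpoch q q j != 0 ->
  qpoch (u * x) q j != 0 -> qpoch (u * y) q j != 0 ->
  \sum_(i < j.+1)
    ((1 - u * x * q ^+ k) * (1 - u * y * q ^+ k) *
      saalschutz_term q x y u k.+1 i -
     u * (1 - x * q ^+ k) * (1 - y * q ^+ k) * saalschutz_term q x y u k i) =
  (1 - x * y * u * q ^+ k * q ^+ k) * qpoch (q ^- k) q j *
  qpoch (x * y * u * q ^+ k) q j * qpoch u q j.+1 /
  (qpoch q q j * qpoch (u * x) q j * qpoch (u * y) q j).
Proof.
move=> q0; elim: j => [|j IH].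
  by move=> _ _ _; rewrite big_ord1 /saalschutz_term !qpochS !qpoch0 expr0;
    field.
move=> /qpoch_neq0S[h1 h1'] /qpoch_neq0S[h2 h2'] /qpoch_neq0S[h3 h3'].
rewrite big_ord_recr /= IH //= /saalschutz_term {IH}.
have qk : q ^+ k != 0 by rewrite expf_neq0.
rewrite (qpochSl (q ^- k.+1)) (qpochSl (x * y * u / q * q ^+ k)).
have -> : q ^- k.+1 * q = q ^- k by rewrite exprS; field; apply/andP.
have -> : x * y * u / q * q ^+ k * q = x * y * u * q ^+ k by field.
have -> : x * y * u / q * q ^+ k.+1 = x * y * u * q ^+ k by rewrite exprS;
  field.
rewrite !(qpochS _ _ j.+1) !qpochS !(exprS q).
move: h1 h1' h2 h2' h3 h3' qk.
move: (q ^+ j) (q ^+ k) (qpoch _ _ _) (qpoch _ _ _) (qpoch _ _ _) (qpoch _ _ _)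
  (qpoch _ _ _) (qpoch _ _ _) => J K P1 P2 P3 P4 P5 P6 h1 h1' h2 h2' h3 h3' qk.
field.
by rewrite ?q0 ?qk ?h1 ?h2 ?h3 ?h1' ?h2' ?h3'.
Qed.

(** A terminating 6W5 with the factors (q^-N; q)_m / (q^(1-N) / D; q)_m
reversed into (D; q)_p / (q; q)_p, where p = N - m. In this form it is
polynomial in D, so that D = 0 needs no separate treatment. *)
Definition W65fin_term q Y Z D N m p : F :=
  vwp (Y * Z) q m * qpoch Y q m * qpoch (Y * Z * D / q * q ^+ N) q m *
  qpoch D q p * Y ^+ p /
  (qpoch q q m * qpoch Z q m * qpoch q q p * qpoch (Y * Z * q ^+ N) q m).

Lemma qpoch_Nexp q k : q != 0 -> qpoch (q ^- k) q k.+1 = 0.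
Proof. by move=> q0; rewrite qpochS mulVf ?subrr ?mulr0 // expf_neq0. Qed.

Lemma saalschutz q x y u k : q != 0 -> qpoch q q k != 0 ->
  qpoch (u * x) q k != 0 -> qpoch (u * y) q k != 0 ->
  \sum_(i < k.+1) saalschutz_term q x y u k i =
  qpoch x q k * qpoch y q k / (qpoch (u * x) q k * qpoch (u * y) q k) * u ^+ k.
Proof.
move=> q0; elim: k => [|k IH].
  by move=> _ _ _; rewrite big_ord1 /saalschutz_term !qpoch0 expr0; field.
move=> h1 h2 h3; have := saalschutz_partial k q0 h1 h2 h3.
rewrite qpoch_Nexp // mulr0 !mul0r sumrB -!mulr_sumr.
rewrite [X in _ - _ * X]big_ord_recr /=.
have -> : saalschutz_term q x y u k k.+1 =
  0 by rewrite /saalschutz_term qpoch_Nexp // !mul0r.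
move: h1 h2 h3 => /qpoch_neq0S[h1 _] /qpoch_neq0S[h2 h2'] /qpoch_neq0S[h3 h3'].
rewrite addr0 IH // => /eqP; rewrite subr_eq0 => /eqP.
set S := \sum_(i < _) _ => e.
have nz : (1 - u * x * q ^+ k) * (1 - u * y * q ^+ k) != 0 by rewrite mulf_neq0.
apply: (mulfI nz); rewrite e !qpochS exprS; field.
by rewrite h2 h3 h2' h3'.
Qed.

(** Telescoping certificate for the first-order recurrence in N satisfied by
the terminating 6W5. The index p keeps track of N - m without subtraction. *)
Lemma W65fin_partial q Y Z D m p : q != 0 -> qpoch q q (m + p).+1 != 0 ->
  qpoch Z q m != 0 -> qpoch (Y * Z * q ^+ (m + p)) q m.+1 != 0 ->
  let N := (m + p)%N in
  \sum_(i < m.+1)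
    ((1 - Z * q ^+ N) * (1 - q * q ^+ N) *
      W65fin_term q Y Z D N.+1 i (N.+1 - i) -
     (1 - Y * Z * q ^+ N) * (1 - Y * D * q ^+ N) *
       W65fin_term q Y Z D N i (N - i)) =
  - (1 - Y * Z * D * q ^+ N * q ^+ N) * qpoch (Y * Z) q m * qpoch Y q m.+1 *
   qpoch (Y * Z * D * q ^+ N) q m * qpoch D q p * Y ^+ p /
  (qpoch q q m * qpoch Z q m * qpoch q q p * qpoch (Y * Z * q ^+ N.+1) q m).
Proof.
move=> q0; elim: m p => [|m IH] p.
  rewrite add0n => /qpoch_neq0S[h1 h1'] _ _ N; rewrite /N.
  rewrite big_ord1 /W65fin_term subn0 subn0 !qpochS !qpoch0 !vwp0 exprS.
  by field; rewrite h1 h1'.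
move=> h1 hZ hw N; rewrite big_ord_recr /=.
have {IH} := IH p.+1; rewrite /= addnS -addSn -/N => -> //; first last.
- by case/qpoch_neq0S: hw.
- by case/qpoch_neq0S: hZ.
have -> : (N.+1 - m.+1 = p.+1)%N by rewrite /N; lia.
have -> : (N - m.+1 = p)%N by rewrite /N; lia.
rewrite /W65fin_term vwpS.
rewrite (qpochSl (Y * Z * D / q * q ^+ N)) (qpochSl (Y * Z * q ^+ N) q m).
have -> : Y * Z * D / q * q ^+ N * q = Y * Z * D * q ^+ N by field.
have -> : Y * Z * D / q * q ^+ N.+1 = Y * Z * D * q ^+ N by rewrite exprS;
  field.
have -> : Y * Z * q ^+ N * q = Y * Z * q ^+ N.+1 by rewrite exprS; ring.
move: hw; rewrite qpochSl.
have -> : Y * Z * q ^+ N * q = Y * Z * q ^+ N.+1 by rewrite exprS; ring.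
rewrite mulf_eq0 negb_or => /andP[hw1] /qpoch_neq0S[hw2 hw2'].
have hm : (m.+1 <= (m.+1 + p).+1)%N by lia.
have hp : (p.+1 <= (m.+1 + p).+1)%N by lia.
have /qpoch_neq0S[g1 g1'] := qpoch_neq0W hm h1.
have /qpoch_neq0S[g2 g2'] := qpoch_neq0W hp h1.
have /qpoch_neq0S[hZ1 hZ2] := hZ.
rewrite (qpochS _ _ m.+1) !qpochS.
move: (qpoch (Y * Z * q ^+ N.+1) q m) (qpoch (Y * Z * D * q ^+ N) q m) hw2 =>
  W V hw2.
move: hw1 hw2'; rewrite /N !addSn !exprS !exprD.
move: h1 => /qpoch_neq0S[_]; rewrite !addSn !exprS !exprD.
have qm0 : q ^+ m != 0 by rewrite expf_neq0.
move: g1 g1' g2 g2' hZ1 hZ2.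
move: (q ^+ m) (q ^+ p) (Y ^+ p) (qpoch _ _ _) (qpoch _ _ _) (qpoch _ _ _)
  (qpoch _ _ _)
  (qpoch _ _ _) (qpoch _ _ _) =>
    M P Yp P1 P2 P3 P4 P5 P6 g1 g1' g2 g2' hZ1 hZ2 h1 hw1 hw2'.
field.
by rewrite g1 g1' g2 g2' hZ1 hZ2 hw1 hw2 hw2' q0.
Qed.

Lemma W65fin_sum q Y Z D N : q != 0 -> qpoch q q N != 0 -> qpoch Z q N != 0 ->
  qpoch (Y * Z) q (N + N) != 0 ->
  \sum_(i < N.+1) W65fin_term q Y Z D N i (N - i) =
  qpoch (Y * Z) q N * qpoch (Y * D) q N / (qpoch Z q N * qpoch q q N).
Proof.
move=> q0; elim: N => [|N IH].
  by move=> _ _ _; rewrite big_ord1 /W65fin_term !qpoch0 vwp0 expr0; field.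
move=> h1 hZ hw.
have hw' : qpoch (Y * Z) q (N + N.+1).+1 != 0 by rewrite -addSn.
have hs : qpoch (Y * Z * q ^+ N) q N.+1 != 0.
  by case/qpoch_neq0S: hw' => /qpoch_neq0_shift.
have hs2 : qpoch (Y * Z * q ^+ N.+1) q N.+1 != 0 by exact: qpoch_neq0_shift hw.
have /qpoch_neq0S[h2 h2'] := h1; have /qpoch_neq0S[hZ1 hZ2] := hZ.
have hww : qpoch (Y * Z) q (N + N) != 0.
  by apply: qpoch_neq0W hw'; rewrite addnS ltnW.
have := @W65fin_partial q Y Z D N 0 q0; rewrite addn0 => /(_ h1 hZ1 hs) /=.
rewrite sumrB -!mulr_sumr IH //.
move=> /eqP; rewrite subr_eq => /eqP e.
have nz : (1 - Z * q ^+ N) * (1 - q * q ^+ N) != 0 by rewrite mulf_neq0.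
(* The certificate stops at m = N; the longer sum has one more term. *)
apply: (mulfI nz); rewrite big_ord_recr /= mulrDr e subnn.
rewrite /W65fin_term vwpS.
have -> : Y * Z * D / q * q ^+ N.+1 = Y * Z * D * q ^+ N by rewrite exprS;
  field.
move: hs hs2; rewrite qpochSl.
have -> : Y * Z * q ^+ N * q = Y * Z * q ^+ N.+1 by rewrite exprS; ring.
rewrite mulf_eq0 negb_or => /andP[g1 g2] /qpoch_neq0S[_ g3].
rewrite !(qpochS _ _ N) !qpoch0.
move: (qpoch (Y * Z * q ^+ N.+1) q N) g2 => W g2.
move: g1 g3; rewrite !exprS !exprD expr0.
move: h2 h2' hZ1 hZ2.
move: (q ^+ N) (qpoch _ _ _) (qpoch _ _ _) (qpoch _ _ _) (qpoch _ _ _)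
  (qpoch _ _ _) => Q P1 P2 P3 P4 P5 h2 h2' hZ1 hZ2 g1 g3.
field.
by rewrite h2 h2' hZ1 hZ2 g2 g3.
Qed.

End Sums.

(** * The telescoping identity behind the 6W5 sum *)

Section W65.
Variable F : numFieldType.
Implicit Types (x y z u q : F) (i j k m n : nat).

(** The general term of the 6W5 of base A = B C D z / q with numerator
parameters B, C, D. Taking the argument z = A q / (B C D) as a parameter
instead of A makes the lower parameters CDz, BDz, BCz polynomial in B, C, D,
z. *)
Definition W65_term q (B C D z : F) m : F :=
  vwp (B * C * D * z) q m * (qpoch B q m * qpoch C q m * qpoch D q m) /
  (qpoch q q m * qpoch (C * D * z) q m * qpoch (B * D * z) q m *
   qpoch (B * C * z) q m) * z ^+ m.

(** Telescoping certificate for the contiguous relation z -> zq: the partial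
sums have a closed form, which carries the factor z^(m+1) and so tends to 0. *)
Lemma W65_partial q (B C D z : F) m :
  qpoch q q m != 0 -> qpoch (C * D * z) q m.+1 != 0 ->
  qpoch (B * D * z) q m.+1 != 0 -> qpoch (B * C * z) q m.+1 != 0 ->
  let x := B * C * D * z in
  \sum_(i < m.+1)
    ((1 - C * D * z) * (1 - B * D * z) * (1 - B * C * z) * (1 - z) *
       W65_term q B C D z i -
     (1 - x) * (1 - B * z) * (1 - C * z) * (1 - D * z) *
       W65_term q B C D (z * q) i) =
  - (qpoch x q m * (qpoch B q m.+1 * qpoch C q m.+1 * qpoch D q m.+1) *
     z ^+ m.+1 * (1 - x * z * q ^+ m)) /
  (qpoch q q m * qpoch (C * D * z * q) q m * qpoch (B * D * z * q) q m *
   qpoch (B * C * z * q) q m).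
Proof.
move=> h1 h2 h3 h4 x; elim: m h1 h2 h3 h4 => [|m IH].
  move=> _ _ _ _; rewrite big_ord1 /W65_term !qpochS !qpoch0 !vwp0 !expr0 /x.
  by field.
move=> /qpoch_neq0S[h1 h1'] h2 h3 h4; rewrite big_ord_recr /=.
have /qpoch_neq0S[h2' _] := h2.
have /qpoch_neq0S[h3' _] := h3.
have /qpoch_neq0S[h4' _] := h4.
rewrite IH // {IH}.
(* 1 - x may vanish, so (1 - x) (xq; q)_m = (x; q)_(m+1) is used undivided. *)
have vq : (1 - x) * vwp (B * C * D * (z * q)) q m.+1 =
  (1 - x * q * q ^+ (m + m).+1) * (qpoch x q m * (1 - x * q ^+ m)).
  rewrite -qpochS qpochSl vwpS mulrCA; congr ((1 - _ * _) * (_ * qpoch _ _ _));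
    rewrite /x; ring.
have -> : (1 - x) * (1 - B * z) * (1 - C * z) * (1 - D * z) *
       W65_term q B C D (z * q) m.+1 =
  ((1 - x) * vwp (B * C * D * (z * q)) q m.+1) *
    ((1 - B * z) * (1 - C * z) * (1 - D * z) *
  (qpoch B q m.+1 * qpoch C q m.+1 * qpoch D q m.+1) /
  (qpoch q q m.+1 * qpoch (C * D * z * q) q m.+1 *
    qpoch (B * D * z * q) q m.+1 *
   qpoch (B * C * z * q) q m.+1) * (z * q) ^+ m.+1).
  by rewrite /W65_term !(mulrA _ z q); ring.
rewrite vq /W65_term vwpS -/x.
rewrite (qpochSl (C * D * z) q m) (qpochSl (B * D * z) q m)
  (qpochSl (B * C * z) q m).
move: h2 h3 h4; rewrite (qpochSl (C * D * z)) (qpochSl (B * D * z))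
  (qpochSl (B * C * z)).
rewrite !mulf_eq0 !negb_or.
move=> /andP[g2 /qpoch_neq0S[g2' g2'']] /andP[g3 /qpoch_neq0S[g3' g3'']].
move=> /andP[g4 /qpoch_neq0S[g4' g4'']].
rewrite (qpochS B q m.+1) (qpochS C q m.+1) (qpochS D q m.+1) !(qpochS _ q m)
  exprMn !exprS !exprD.
move: g2' g3' g4' h1 h1' g2'' g3'' g4''; rewrite /x.
move: (q ^+ m) (z ^+ m) (qpoch _ _ _) (qpoch _ _ _) (qpoch _ _ _) (qpoch _ _ _)
  (qpoch _ _ _) (qpoch _ _ _) (qpoch _ _ _) (qpoch _ _ _) =>
  Q Zm P1 P2 P3 P4 P5 P6 P7 P8 g2' g3' g4' h1 h1' g2'' g3'' g4''.
field.
by rewrite g2 g3 g4 g2' g3' g4' h1 h1' g2'' g3'' g4''.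
Qed.

End W65.

(** * Askey-Wilson polynomials as terminating 8W7 series *)

Section AW.
Variable F : numFieldType.
Implicit Types (x y z u q a b c d : F) (i j k m n : nat).

Lemma triangle_sum (V : zmodType) (f : nat -> nat -> V) n :
  \sum_(k < n) \sum_(j < k.+1) f k j =
  \sum_(j < n) \sum_(m < n - j) f (j + m)%N j.
Proof.
elim: n => [|n IH]; first by rewrite !big_ord0.
rewrite big_ord_recr /= IH [RHS]big_ord_recr /=.
rewrite subSn // subnn big_ord1 addn0 [X in _ + X]big_ord_recr /=
  addrA -big_split /=.
congr (_ + _); apply: eq_bigr => j _.
by rewrite subSn 1?ltnW // big_ord_recr /= subnKC // ltnW.
Qed.

(** (q^-(j+m); q)_j is (q; q)_(j+m) / (q; q)_m up to the sign and power of q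
of reversing the factors; comparing two values of m eliminates these. *)
Lemma qpoch_Nexp_cross q j m p : q != 0 ->
  qpoch (q ^- (j + m)) q j * (q ^+ j) ^+ m * qpoch q q m * qpoch q q (j + p) =
  qpoch (q ^- (j + p)) q j * (q ^+ j) ^+ p * qpoch q q p * qpoch q q (j + m).
Proof.
move=> q0; elim: j => [|j IH].
  by rewrite !qpoch0 !add0n expr0 !expr1n !mulr1 !mul1r mulrC.
have e s : q ^- (j.+1 + s) * q = q ^- (j + s).
  by rewrite addSn exprS; field; rewrite q0 expf_neq0.
rewrite (qpochSl (q ^- (j.+1 + m))) (qpochSl (q ^- (j.+1 + p))) !e.
rewrite !addSn !(qpochS q).
have {}e s r : (1 - q ^- (j + s).+1) * (q ^+ j.+1) ^+ s *
  (1 - q * q ^+ (j + r)) =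
   - (q ^+ j) ^+ s * (1 - q * q ^+ (j + s)) * (1 - q * q ^+ (j + r)) /
     (q * q ^+ j).
  rewrite !exprS exprMn !exprD; field.
  by rewrite q0 !expf_neq0.
transitivity (((1 - q ^- (j + m).+1) * (q ^+ j.+1) ^+ m *
  (1 - q * q ^+ (j + p))) *
  (qpoch (q ^- (j + m)) q j * qpoch q q m * qpoch q q (j + p))); first by ring.
transitivity (((1 - q ^- (j + p).+1) * (q ^+ j.+1) ^+ p *
  (1 - q * q ^+ (j + m))) *
  (qpoch (q ^- (j + p)) q j * qpoch q q p * qpoch q q (j + m))); last by ring.
rewrite !e.
transitivity (- (1 - q * q ^+ (j + m)) * (1 - q * q ^+ (j + p)) / (q * q ^+ j) *
 (qpoch (q ^- (j + m)) q j * (q ^+ j) ^+ m * qpoch q q m * qpoch q q (j + p))).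
  by ring.
by rewrite IH; ring.
Qed.

(** The 8W7 of base abcz/q with numerator parameters az, bz, cz, abcd q^(n-1),
q^-n and argument q/(dz), times z^n (d/z; q)_n / (abcz; q)_n. The factors
(q^-n; q)_k / (z q^(1-n) / d; q)_k are reversed, which clears d from the
denominators, and n + k is kept in one factorial so that the sum over n >= k
is again very-well-poised. *)
Definition aw_vwp q n z a b c d : F :=
  z ^+ n * \sum_(k < n.+1)
    vwp (a * b * c * z) q k *
    (qpoch (a * z) q k * qpoch (b * z) q k * qpoch (c * z) q k) /
    (qpoch q q k * qpoch (b * c) q k * qpoch (a * c) q k * qpoch (a * b) q k) *
    (qpoch q q n * qpoch (a * b * c * d / q * q ^+ n) q k *
      qpoch (d / z) q (n - k) /
     (qpoch q q (n - k) * qpoch (a * b * c * z) q (n + k))) * z ^- k * z ^- k.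

(** After substituting k = j + m, the summand separates into a factor that
depends on j and n only and the m-th term of a terminating 6W5. *)
Lemma aw_summand_split q z a b c d w n j m p :
  n = (j + (m + p))%N -> w = a * b * c * z -> q != 0 -> a != 0 -> z != 0 ->
    qpoch q q n != 0 -> qpoch (a * b) q n != 0 ->
  qpoch (a * c) q n != 0 -> qpoch (b * c) q n != 0 ->
  qpoch w q (n + n) != 0 ->
  vwp w q (j + m) * qpoch (a * z) q (j + m) *
    (qpoch q q n * qpoch (a * b * c * d / q * q ^+ n) q (j + m) *
      qpoch (d / z) q p) /
    (qpoch q q (j + m) * qpoch (b * c) q (j + m) * qpoch q q p *
     qpoch w q (n + (j + m))) *
    z ^+ n * z ^- (j + m) * a ^- (j + m) *
    saalschutz_term q (b * z) (c * z) (a / z) (j + m) j =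
  a ^- n * (qpoch (q ^- n) q j * qpoch (a / z) q j * qpoch (a * z) q j *
    qpoch (a * b * c * d / q * q ^+ n) q j) /
    (qpoch q q j * qpoch (a * b) q j * qpoch (a * c) q j * qpoch (b * c) q j) *
    q ^+ j * (qpoch q q (m + p) / qpoch (w * q ^+ (j + j)) q (m + p)) *
    W65fin_term q (a * z * q ^+ j) (b * c * q ^+ j) (d / z) (m + p) m p.
Proof.
move=> en ew.
have e3 : (n + (j + m) = (j + j) + ((m + p) + m))%N by lia.
have e4 : (n + n = n + (j + m) + p)%N by lia.
have [lj ljm lm lp lmp] : [/\ j <= n, j + m <= n, m <= n, p <= n & m + p <=
  n]%N.
  by split; lia.
move=> q0 a0 z0 hq hab hac hbc hw.
rewrite /saalschutz_term /W65fin_term.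
have -> : b * z * (c * z) * (a / z) / q = w / q by rewrite ew; field;
  rewrite ?z0 ?q0.
have -> : a / z * (b * z) = a * b by field.
have -> : a / z * (c * z) = a * c by field.
have -> : a * z * q ^+ j * (b * c * q ^+ j) = w * q ^+ (j + j).
  by rewrite exprD ew; ring.
have -> : w * q ^+ (j + j) * (d / z) / q * q ^+ (m + p) =
   a * b * c * d / q * q ^+ n * q ^+ j.
  by rewrite en ew !exprD; field; rewrite z0 q0.
have hX := qpoch_neq0W ljm hbc.
have hQ := qpoch_neq0W ljm hq.
have hm := qpoch_neq0W lm hq.
have hp := qpoch_neq0W lp hq.
have e1 : qpoch (q ^- (j + m)) q j = qpoch (q ^- n) q j * (q ^+ j) ^+ p *
   qpoch q q (m + p) * qpoch q q (j + m) / (qpoch q q m * qpoch q q n).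
  have := qpoch_Nexp_cross j m (m + p) q0; rewrite -en (exprD (q ^+ j)) => e.
  have qj : (q ^+ j) ^+ m != 0 by rewrite !expf_neq0.
  apply: (mulIf qj); apply: (mulIf hm); apply: (mulIf hq); rewrite e.
  by field; rewrite hm hq.
have e2 := vwp_qpoch w j m q0.
transitivity ((vwp w q (j + m) * qpoch (w / q * q ^+ (j + m)) q j) *
  (qpoch (a * z) q (j + m) *
    (qpoch q q n * qpoch (a * b * c * d / q * q ^+ n) q (j + m) *
      qpoch (d / z) q p) /
    (qpoch q q (j + m) * qpoch (b * c) q (j + m) * qpoch q q p *
     qpoch w q (n + (j + m))) *
    z ^+ n * z ^- (j + m) * a ^- (j + m) *
  (qpoch (q ^- (j + m)) q j * qpoch (a / z) q j /
  (qpoch q q j * qpoch (a * b) q j * qpoch (a * c) q j) * q ^+ j)));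
    first by ring.
rewrite e2 e1.
move: hw; rewrite e4.
rewrite qpochD mulf_eq0 negb_or => /andP[+ _].
rewrite e3 (qpochD w) (qpochD (w * _)) !mulf_eq0 !negb_or.
move=> /andP[g1 /andP[g2 g3]].
have g4 := qpoch_neq0W lj hq; have g5 := qpoch_neq0W lj hab.
have g6 := qpoch_neq0W lj hac.
move: hX; rewrite !(qpochD (b * c)) (qpochD (a * z))
  (qpochD (a * b * c * d / q * _)).
rewrite mulf_eq0 negb_or => /andP[g7 g8].
rewrite (exprD z j m) (exprD a j m).
have -> : z ^+ n = z ^+ j * z ^+ m * z ^+ p by rewrite en !exprD mulrA.
have -> : a ^+ n = a ^+ j * a ^+ m * a ^+ p by rewrite en !exprD mulrA.
rewrite !exprMn.
have g9 : q ^+ j != 0 by rewrite expf_neq0.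
have ga k : a ^+ k != 0 by rewrite expf_neq0.
have gz k : z ^+ k != 0 by rewrite expf_neq0.
have g10 := qpoch_neq0W lmp hq.
move: g1 g2 g3 g4 g5 g6 g7 g8 g9 g10 hm hp hq hQ (ga j) (ga m) (ga p) (gz j)
  (gz m) (gz p).
move: (q ^+ j ^+ p) (q ^+ j) => qjp qj.
abstract_qpoch.
move: (a ^+ j) (a ^+ m) (a ^+ p) (z ^+ j) (z ^+ m) (z ^+ p) (vwp _ _ _).
move=> *; field.
by split_nonzero.
Qed.

(** Watson's transformation. Expanding (bz, cz; q)_k / (ac, ab; q)_k in the
8W7 by Saalschutz's sum and exchanging the two sums leaves an inner
terminating 6W5; its value turns the outer sum into the defining 4phi3. *)
Lemma aw_formula_vwp q n z b c d a :
  q != 0 -> a != 0 -> z != 0 -> qpoch q q n != 0 -> qpoch (a * b) q n != 0 ->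
  qpoch (a * c) q n != 0 -> qpoch (a * d) q n != 0 -> qpoch (b * c) q n != 0 ->
  qpoch (a * b * c * z) q (n + n) != 0 ->
  aw_formula q n z b c d a =
  qpoch (a * b) q n * qpoch (a * c) q n * qpoch (b * c) q n *
    aw_vwp q n z a b c d.
Proof.
move=> q0 a0 z0 hq hab hac had hbc hw.
set w := a * b * c * z in hw *.
have ga k : a ^+ k != 0 by rewrite expf_neq0.
have gz k : z ^+ k != 0 by rewrite expf_neq0.
pose f k j := vwp w q k * qpoch (a * z) q k *
    (qpoch q q n * qpoch (a * b * c * d / q * q ^+ n) q k *
      qpoch (d / z) q (n - k)) /
    (qpoch q q k * qpoch (b * c) q k * qpoch q q (n - k) *
     qpoch w q (n + k)) *
    z ^+ n * z ^- k * a ^- k *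
    saalschutz_term q (b * z) (c * z) (a / z) k j.
have -> : aw_vwp q n z a b c d = \sum_(k < n.+1) \sum_(j < k.+1) f k j.
  rewrite /aw_vwp mulr_sumr; apply: eq_bigr => k _.
  have kn : (k <= n)%N by rewrite -ltnS.
  have hk := qpoch_neq0W kn hq; have hk1 := qpoch_neq0W kn hab.
  have hk2 := qpoch_neq0W kn hac; have hk3 := qpoch_neq0W kn hbc.
  have hk4 := qpoch_neq0W (leq_subr k n) hq.
  have hk5 : qpoch w q (n + k) != 0 by apply: qpoch_neq0W hw; rewrite leq_add2l.
  rewrite /f -mulr_sumr saalschutz //.
  - have -> : a / z * (b * z) = a * b by field.
    have -> : a / z * (c * z) = a * c by field.
    rewrite -/w expr_div_n.
    move: hk hk1 hk2 hk3 hk4 hk5 (ga k) (gz k) (gz n).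
    abstract_qpoch.
    move: (vwp _ _ _) (a ^+ k) (z ^+ k) (z ^+ n); move=> *; field.
    by split_nonzero.
  - by have -> : a / z * (b * z) = a * b by field.
  - by have -> : a / z * (c * z) = a * c by field.
rewrite triangle_sum /aw_formula big_mkord mulr_sumr mulr_sumr.
apply: eq_bigr => j _.
have jn : (j <= n)%N by rewrite -ltnS.
rewrite subSn //; set N := (n - j)%N.
have en : n = (j + N)%N by rewrite subnKC.
rewrite (eq_bigr (fun m : 'I_N.+1 =>
  a ^- n * (qpoch (q ^- n) q j * qpoch (a / z) q j * qpoch (a * z) q j *
    qpoch (a * b * c * d / q * q ^+ n) q j) /
    (qpoch q q j * qpoch (a * b) q j * qpoch (a * c) q j * qpoch (b * c) q j) *
    q ^+ j * (qpoch q q N / qpoch (w * q ^+ (j + j)) q N) *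
    W65fin_term q (a * z * q ^+ j) (b * c * q ^+ j) (d / z) N m (N - m)));
      last first.
  move=> m _; have mN : (m <= N)%N by rewrite -ltnS.
  rewrite /f; have -> : (n - (j + m) = N - m)%N by rewrite subnDA.
  by have := @aw_summand_split q z a b c d w n j m (N - m); rewrite (subnKC mN);
    apply.
have Nn : (N <= n)%N by rewrite leq_subr.
have hN := qpoch_neq0W Nn hq.
have hj := qpoch_neq0W jn hq.
have YZ : a * z * q ^+ j * (b * c * q ^+ j) = w * q ^+ (j + j).
  by rewrite exprD /w; ring.
have hwN : qpoch (w * q ^+ (j + j)) q (N + N) != 0.
  by apply: qpoch_neq0_shift; rewrite addnACA -en.
have qD x : qpoch x q n = qpoch x q j * qpoch (x * q ^+ j) q N.
  by rewrite -qpochD -en.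
move: hab hac had hbc; rewrite 4!qD !mulf_eq0 !negb_or.
move=> /andP[h1 h1'] /andP[h2 h2'] /andP[h3 h3'] /andP[h4 h4'].
rewrite -mulr_sumr W65fin_sum ?YZ //.
have -> : a * z * q ^+ j * (d / z) = a * d * q ^+ j by field.
rewrite /qpochs !big_cons !big_nil expfzDr // exprN1.
have -> : a * b * c * d * (q ^ n * q^-1) = a * b * c * d / q * q ^+
  n by rewrite mulrCA mulrC.
have {}hwN := qpoch_neq0W (leq_addr N N) hwN.
rewrite (qD (a * b)) (qD (a * c)) (qD (a * d)).
move: h1 h1' h2 h2' h3 h3' h4 h4' hN hj hwN (ga n).
abstract_qpoch.
move: (a ^+ n) (q ^+ j); move=> *; field.
by split_nonzero.
Qed.

End AW.

(** * Geometrically dominated series *)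

(** The only completeness needed below, stated for an abstract field with a
norm; it also forces the field to be archimedean, see [cvg_expr0]. *)
Definition geom_complete (F : numFieldType) := forall (u : nat -> F) (K r : F),
  0 <= r < 1 -> (forall n, `|u n| <= K * r ^+ n) -> cvgn (series u).

Section Limits.
Variable F : numFieldType.
Hypothesis FC : geom_complete F.
Implicit Types (u v : nat -> F) (r K l : F).

(** Powers of r tend to 0 because they are the terms of a convergent series. *)
Lemma cvg_expr0 r : 0 <= r < 1 -> (fun n => r ^+ n) @ \oo --> (0 : F).
Proof.
move=> r01; apply: cvg_series_cvg_0; apply: (FC (K := 1) r01) => n.
by case/andP: r01 => r0 _; rewrite mul1r ger0_norm // exprn_ge0.
Qed.

Lemma cvg_dominated u v l : v @ \oo --> (0 : F) ->
  (forall n, `|u n - l| <= v n) -> u @ \oo --> l.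
Proof.
move=> v0 uv; apply/cvgrPdist_lt => e e0.
near=> n; rewrite distrC; apply: (le_lt_trans (uv n)).
have vn : 0 <= v n := le_trans (normr_ge0 _) (uv n).
rewrite -(ger0_norm vn) -normrN -[- v n]add0r.
near: n; move/cvgrPdist_lt : v0; exact.
Unshelve. all: by end_near. Qed.

Lemma cvg_norm_le u l K : u @ \oo --> l ->
  (\forall n \near \oo, `|u n| <= K) -> `|l| <= K.
Proof.
move=> ul uK.
have Kr : K \is Num.real.
  have [N _ /(_ N (leqnn N))] := uK.
  by move=> /(le_trans (normr_ge0 _)) /ger0_real.
rewrite real_leNgt ?normr_real //; apply/negP => Kl.
have : \forall n \near \oo, `|l - u n| < `|l| - K.
  by move/cvgrPdist_lt : ul; apply; rewrite subr_gt0.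
move=> [N _ hN]; have [M _ hM] := uK.
have := hN (maxn N M) (leq_maxl _ _); have := hM (maxn N M) (leq_maxr _ _) =>
  h1 h2.
have := ltr_leD h2 h1; rewrite subrK => /(le_lt_trans (ler_normD _ _)).
by rewrite subrK ltxx.
Qed.

Lemma sum_expr_le r n : 0 <= r < 1 -> \sum_(i < n) r ^+ i <= (1 - r)^-1.
Proof.
move=> /andP[r0 r1]; have r1' : 0 < 1 - r by rewrite subr_gt0.
rewrite -[leRHS]mul1r ler_pdivlMr // mulrC -opprB mulNr -subrX1 opprB.
by rewrite gerBl exprn_ge0.
Qed.

Lemma series_tail_le u K r M : 0 <= r < 1 -> (forall n, `|u n| <= K * r ^+ n) ->
  `|limn (series u) - series u M| <= K * r ^+ M / (1 - r).
Proof.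
move=> r01 uK; have cu := FC r01 uK.
have K0 : 0 <= K by have := uK 0%N; rewrite expr0 mulr1; apply: le_trans.
apply: (@cvg_norm_le (fun n => series u n - series u M)).
  by apply: cvgB => //; exact: cvg_cst.
exists M => // n /= Mn; rewrite /series /= -(subnKC Mn).
rewrite !big_mkord big_split_ord /= addrAC subrr add0r.
apply: (le_trans (ler_norm_sum _ _ _)).
apply: (@le_trans _ _ (\sum_(i < n - M) (K * r ^+ M) * r ^+ i)).
  by apply: ler_sum => i _; rewrite -mulrA -exprD.
rewrite -mulr_sumr ler_wpM2l ?sum_expr_le //.
by rewrite mulr_ge0 // exprn_ge0 //; case/andP: r01.
Qed.

(** Summation of a geometrically dominated double series along diagonals. The
difference between the diagonal and the row-wise partial sums is a sum of
tails of rows, all of total degree M; estimating the tails with a ratio s > r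
makes the sum over the rows converge uniformly. *)
Lemma series_diagonal (T : nat -> nat -> F) K r (B : F) : 0 <= r < 1 ->
  (forall k m, `|T k m| <= K * r ^+ (k + m)) ->
  series (fun k => limn (series (T k))) @ \oo --> B ->
  series (fun n => \sum_(k < n.+1) T k (n - k)%N) @ \oo --> B.
Proof.
move=> /andP[r0 r1] TK cB.
have K0 : 0 <= K by have := TK 0%N 0%N; rewrite expr0 mulr1; apply: le_trans.
(* A ratio s > r leaves the summable factor (r / s)^k for the k-th row. *)
have [s rs s1] : exists2 s, r < s & s < 1.
  by exists ((r + 1) / 2); case: (midf_lt r1).
have s0 : 0 < s by exact: le_lt_trans rs.
have s01 : 0 <= s < 1 by rewrite s1 ltW.
have t01 : 0 <= r / s < 1 by rewrite divr_ge0 ?(ltW s0) //= ltr_pdivrMr ?mul1r.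
pose A k : F := limn (series (T k)).
pose E M := K / (1 - s) / (1 - r / s) * s ^+ M.
have dE M : `|series (fun n => \sum_(k < n.+1) T k (n - k)%N) M - series A M| <=
  E M.
  rewrite /series /= !big_mkord (triangle_sum (fun n k => T k (n - k)%N)).
  rewrite -sumrB; apply: (le_trans (ler_norm_sum _ _ _)).
  apply: (@le_trans _ _ (\sum_(k < M) (K / (1 - s) * s ^+ M) * (r / s) ^+ k)).
    apply: ler_sum => k _; rewrite distrC.
    have sT : \sum_(m < M - k) T k (k + m - k)%N = series (T k) (M - k)%N.
      by rewrite /series /= big_mkord; apply: eq_bigr => m _; rewrite addKn.
    rewrite sT; have kM : (k <= M)%N by exact: ltnW.
    have Ts m : `|T k m| <= (K * r ^+ k) * s ^+ m.
      apply: (le_trans (TK k m)); rewrite exprD mulrA ler_wpM2l //.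
        by rewrite mulr_ge0 ?exprn_ge0.
      by rewrite lerXn2r ?nnegrE // ltW.
    apply: (le_trans (series_tail_le (M - k) s01 Ts)).
    rewrite le_eqVlt; apply/orP; left; apply/eqP.
    have -> : s ^+ M = s ^+ (M - k) * s ^+ k by rewrite -exprD subnK.
    have sk : s ^+ k != 0 by rewrite expf_neq0 ?gt_eqF.
    rewrite expr_div_n; move: (s ^+ (M - k)) (s ^+ k) (r ^+ k) sk => x y z yn0.
     by field; rewrite yn0 gt_eqF ?subr_gt0.
  rewrite -mulr_sumr /E [leRHS]mulrAC ler_wpM2l ?sum_expr_le //.
  by rewrite mulr_ge0 ?exprn_ge0 ?(ltW s0) // divr_ge0 // subr_ge0 ltW.
have E0 : E @ \oo --> (0 : F).
  by rewrite -[0](mulr0 (K / (1 - s) / (1 - r / s))); apply: cvgMl_tmp;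
    exact: cvg_expr0.
have := cvg_dominated (l := 0) E0 (u := fun M =>
  series (fun n => \sum_(k < n.+1) T k (n - k)%N) M - series A M).
move=> /(_ _) h.
rewrite -[B]add0r.
have -> : series (fun n => \sum_(k < n.+1) T k (n - k)%N) =
  (fun M => (series (fun n => \sum_(k < n.+1) T k (n - k)%N) M - series A M) +
    series A M).
  by apply: funext => M; rewrite subrK.
apply: cvgD => //; apply: h => M; rewrite subr0; exact: dE.
Qed.

End Limits.

(** * Bounded families *)

Section Bounded.
Variable F : numFieldType.

Definition bdd (I : Type) (f : I -> F) := exists2 K : F, 0 <= K & forall i,
  `|f i| <= K.

Lemma bdd_cst (I : Type) (x : F) : bdd (fun _ : I => x).
Proof. by exists `|x|. Qed.

Lemma bddM (I : Type) (f g : I -> F) : bdd f -> bdd g ->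
  bdd (fun i => f i * g i).
Proof.
move=> [K K0 fK] [L L0 gL]; exists (K * L); first exact: mulr_ge0.
by move=> i; rewrite normrM ler_pM.
Qed.

Lemma bddD (I : Type) (f g : I -> F) : bdd f -> bdd g ->
  bdd (fun i => f i + g i).
Proof.
move=> [K K0 fK] [L L0 gL]; exists (K + L); first exact: addr_ge0.
by move=> i; apply: (le_trans (ler_normD _ _)); rewrite lerD.
Qed.

Lemma bdd_comp (I J : Type) (h : J -> I) (f : I -> F) : bdd f ->
  bdd (fun j => f (h j)).
Proof. by move=> [K K0 fK]; exists K => // j; exact: fK. Qed.

Lemma bdd_expr (q : F) : `|q| < 1 -> bdd (fun n => q ^+ n).
Proof.
by move=> q1; exists 1 => // n; rewrite normrX exprn_ile1 // ltW.
Qed.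

End Bounded.

(** * Infinite products: uniform bounds and convergence *)

Section Near.
Variable F : numFieldType.
Hypothesis FC : geom_complete F.
Variable q : F.
Hypothesis q1 : `|q| < 1.
Implicit Types (x y z : F) (i j k m n : nat).

Local Notation r := `|q|.

Let r01 : 0 <= r < 1. Proof. by rewrite normr_ge0 q1. Qed.
Let r1 : 0 < 1 - r. Proof. by rewrite subr_gt0. Qed.

(** Once |x| is small compared with 1 - |q|, the product of all factors stays
within 1/2 of 1, by a first-order estimate. *)
Lemma qpoch_near1 x m : `|x| * 4 <= 1 - r ->
  `|qpoch x q m| <= 2 /\ `|qpoch x q m - 1| <= 2^-1.
Proof.
move=> x4.
have key : `|qpoch x q m - 1| <= 2 * `|x| * \sum_(i < m) r ^+ i /\
  `|qpoch x q m - 1| <= 2^-1.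
  elim: m => [|m [IH IH']]; first by rewrite qpoch0 subrr normr0 big_ord0 mulr0.
  have h : `|qpoch x q m.+1 - 1| <= 2 * `|x| * \sum_(i < m.+1) r ^+ i.
    rewrite qpochS big_ord_recr /= [leRHS]mulrDr.
    have -> : qpoch x q m * (1 - x * q ^+ m) - 1 =
      (qpoch x q m - 1) - qpoch x q m * (x * q ^+ m) by ring.
    apply: (le_trans (ler_normB _ _)); apply: lerD => //.
    rewrite !normrM normrX mulrA ler_wpM2r ?exprn_ge0 // ler_wpM2r //.
    rewrite -[qpoch x q m](subrK 1); apply: (le_trans (ler_normD _ _)).
    rewrite normr1 -[leRHS]/(1 + 1) lerD2r (le_trans IH') // invf_le1 ?ler1n //.
  split => //; apply: (le_trans h).
  apply: (@le_trans _ _ (2 * `|x| * (1 - r)^-1)).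
    by rewrite ler_wpM2l ?sum_expr_le // mulr_ge0.
  rewrite ler_pdivrMr // ler_pdivlMl //.
  by rewrite mulrA mulrC -natrM.
have [_ h] := key; split => //.
rewrite -[qpoch x q m](subrK 1); apply: (le_trans (ler_normD _ _)).
by rewrite normr1 -[leRHS]/(1 + 1) lerD2r (le_trans h) // invf_le1 ?ler1n.
Qed.

Lemma small_shift x : exists J, forall i, (J <= i)%N ->
  `|x * q ^+ i| * 4 <= 1 - r.
Proof.
have : (fun n => (`|x| * 4) * r ^+ n) @ \oo --> ((`|x| * 4) * 0 : F).
  by apply: cvgMl_tmp; exact: cvg_expr0.
rewrite mulr0 => /cvgrPdist_le /(_ _ r1) [J _ hJ]; exists J => i /hJ /=.
rewrite sub0r normrN ger0_norm; last by rewrite !mulr_ge0 ?exprn_ge0.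
by rewrite normrM normrX mulrAC.
Qed.

(** Replacing each factor by 1 + |x| |q|^j majorizes all shifted factorials at
once, and the majorant is itself a shifted factorial, of base |q|. *)
Lemma qpoch_majorant x i m : `|qpoch (x * q ^+ i) q m| <= qpoch (- `|x|) r m.
Proof.
elim: m => [|m IH]; first by rewrite !qpoch0 normr1.
rewrite !qpochS normrM ler_pM //.
apply: (le_trans (ler_normB _ _)); rewrite normr1 mulNr opprK lerD2l.
rewrite !normrM !normrX ler_wpM2r ?exprn_ge0 // ler_piMr // exprn_ile1 //.
by rewrite ltW.
Qed.

End Near.

Section Pochhammer.
Variable F : numFieldType.
Hypothesis FC : geom_complete F.
Variable q : F.
Hypothesis q1 : `|q| < 1.
Implicit Types (x y z : F) (i j k m n : nat).

Local Notation r := `|q|.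

Let r01 : 0 <= r < 1. Proof. by rewrite normr_ge0 q1. Qed.
Let r1 : 0 < 1 - r. Proof. by rewrite subr_gt0. Qed.

(** Beyond a fixed index J the majorant is controlled by [qpoch_near1], and
its factors are at least 1, so inserting the first J of them only increases
it. *)
Lemma qpoch_bdd x : bdd (fun p : nat * nat => qpoch (x * q ^+ p.1) q p.2).
Proof.
have [J hJ] := small_shift FC q1 x.
exists (`|qpoch (- `|x|) r J| * 2); first by rewrite mulr_ge0.
move=> [i m] /=; apply: (le_trans (qpoch_majorant q1 x i m)).
have xr k : 0 <= 1 - - `|x| * r ^+ k by rewrite mulNr opprK addr_ge0 //
  mulr_ge0 ?exprn_ge0.
have ge0 k : 0 <= qpoch (- `|x|) r k.
  by elim: k => [|k IH]; rewrite ?qpoch0 // qpochS mulr_ge0.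
have ge1 y k : 1 <= qpoch (- `|y|) r k.
  elim: k => [|k IH]; rewrite ?qpoch0 // qpochS -[leLHS]mulr1 ler_pM //.
  by rewrite mulNr opprK lerDl mulr_ge0 ?exprn_ge0.

apply: (@le_trans _ _ (qpoch (- `|x|) r (m + J))).
  rewrite qpochD ler_peMr //.
  have -> : - `|x| * r ^+ m = - `| (`|x| * r ^+ m) |.
    by rewrite mulNr normrM normrX !normr_id.
  exact: ge1.
rewrite addnC qpochD (ger0_norm (ge0 J)) ler_wpM2l //.
have nr : `|r| < 1 by rewrite normr_id.
have := @qpoch_near1 _ r nr (- `|x| * r ^+ J) m.
rewrite normr_id mulNr normrN normrM normrX !normr_id => /(_ _) [|+ _].
  by have := hJ J (leqnn J); rewrite normrM normrX.
apply: le_trans.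
have -> : - (`|x| * r ^+ J) = - `|x * q ^+ J| by rewrite normrM normrX.
by apply: real_ler_norm; apply/ger0_real/(le_trans ler01).
Qed.

(** Far out the factors are close to 1, so only finitely many values of the
index remain; a shifted factorial is a quotient of two unshifted ones. *)
Lemma qpoch_inv_bdd x : (forall m, qpoch x q m != 0) ->
  bdd (fun p : nat * nat => (qpoch (x * q ^+ p.1) q p.2)^-1).
Proof.
move=> x0; have [J hJ] := small_shift FC q1 x; have [K K0 hK] := qpoch_bdd x.
have h m : `|(qpoch x q m)^-1| <= `|(qpoch x q J)^-1| * (2 + K).
  have [Jm|mJ] := leqP J m.
    rewrite -(subnKC Jm) qpochD invfM normrM ler_wpM2l //.
    apply: (@le_trans _ _ 2); last by rewrite lerDl.
    have [_ h] := qpoch_near1 q1 (m - J) (hJ J (leqnn J)).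
    rewrite normfV -[leRHS]invrK lef_pV2 ?posrE //; last first.
      by rewrite normr_gt0; apply: qpoch_neq0_shift; rewrite subnKC.
    set y := qpoch _ _ _ in h *.
    have := ler_normD y (1 - y); rewrite addrC subrK normr1 => h1.
    have h2 : 1 <= `|y| + 2^-1.
      by apply: (le_trans h1); rewrite lerD2l distrC.
    rewrite -(lerD2r 2^-1); apply: le_trans h2.
    by have -> : 2^-1 + 2^-1 = 1 :> F by field.
  have eJ : J = (m + (J - m))%N by rewrite subnKC // ltnW.
  rewrite [in leRHS]eJ.
  have mJx : qpoch (x * q ^+ m) q (J - m) != 0.
    by apply: qpoch_neq0_shift; rewrite subnKC // ltnW.
  rewrite qpochD invfM normrM -mulrA ler_peMr //.
  rewrite normfV mulrC ler_pdivlMr ?normr_gt0 // mul1r.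
  by apply: (le_trans (hK (m, (J - m)%N))); rewrite lerDr.
exists (K * (`|(qpoch x q J)^-1| * (2 + K))).
  by rewrite mulr_ge0 // mulr_ge0 // addr_ge0.
move=> [i m] /=; have -> : (qpoch (x * q ^+ i) q m)^-1 = qpoch x q i *
  (qpoch x q (i + m))^-1.
  by rewrite qpochD invfM mulrA mulfV ?mul1r.
rewrite normrM ler_pM //.
by have := hK (0%N, i); rewrite /= expr0 mulr1.
Qed.

Lemma cvg_qpoch x : qpoch x q n @[n --> \oo] --> qpoch_inf x q.
Proof.
have [K K0 hK] := qpoch_bdd x.
suff : cvgn (qpoch x q) by [].
have -> : (qpoch x q) =
  (fun n => 1 + series (fun k => - (qpoch x q k * (x * q ^+ k))) n).
  apply: funext => n; rewrite /series /= big_mkord.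
  elim: n => [|n IH]; first by rewrite big_ord0 addr0 qpoch0.
  by rewrite big_ord_recr /= addrA -IH qpochS mulrBr mulr1.
apply: is_cvgD; first exact: is_cvg_cst.
apply: (FC (K := `|x| * K) r01) => k.
rewrite normrN !normrM normrX mulrA; apply: ler_wpM2r; rewrite ?exprn_ge0 //.
rewrite mulrC; apply: ler_wpM2l => //.
by have := hK (0%N, k); rewrite /= expr0 mulr1.
Qed.

Lemma qpoch_inf_neq0 x : qpoch_inf x q != 0 -> forall m, qpoch x q m != 0.
Proof.
move=> h m; apply/negP => /eqP xm; case/eqP: h.
apply/cvg_lim => //; apply: cvg_near_cst; exists m => // n /= mn.
by rewrite -(subnKC mn) qpochD xm mul0r.
Qed.

Lemma qpoch_inf_shift x i : qpoch_inf x q = qpoch x q i *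
  qpoch_inf (x * q ^+ i) q.
Proof.
apply/cvg_lim => //; rewrite -(cvg_shiftn i) /=.
have -> : (fun n => qpoch x q (n + i)) =
  (fun n => qpoch x q i * qpoch (x * q ^+ i) q n).
  by apply: funext => n; rewrite addnC qpochD.
by apply: cvgMl_tmp; exact: cvg_qpoch.
Qed.

End Pochhammer.

(** * The nonterminating 6W5 sum *)

Section Sum65.
Variable F : numFieldType.
Hypothesis FC : geom_complete F.
Variable q : F.
Hypothesis q1 : `|q| < 1.
Implicit Types (x y z : F) (i j k m n : nat).

Lemma eq_bdd (I : Type) (f g : I -> F) : f =1 g -> bdd f -> bdd g.
Proof. by move=> /funext ->. Qed.

Lemma bdd_qpoch (I : Type) x (h : I -> nat) : bdd (fun p => qpoch x q (h p)).
Proof.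
apply: eq_bdd (bdd_comp (fun p => (0%N, h p)) (qpoch_bdd FC q1 x)) => p /=.
by rewrite expr0 mulr1.
Qed.

Lemma bdd_qpoch_shift (I : Type) x (g h : I -> nat) :
  bdd (fun p => qpoch (x * q ^+ g p) q (h p)).
Proof. exact: (bdd_comp (fun p => (g p, h p)) (qpoch_bdd FC q1 x)). Qed.

Lemma bdd_qpoch_inv_shift (I : Type) x (g h : I -> nat) :
  (forall m, qpoch x q m != 0) ->
  bdd (fun p => (qpoch (x * q ^+ g p) q (h p))^-1).
Proof. move=> x0; exact: (bdd_comp (fun p =>
  (g p, h p)) (qpoch_inv_bdd FC q1 x0)). Qed.

Lemma bdd_qpoch_inv (I : Type) x (h : I -> nat) :
  (forall m, qpoch x q m != 0) ->
  bdd (fun p => (qpoch x q (h p))^-1).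
Proof.
move=> x0; apply: eq_bdd (bdd_qpoch_inv_shift (fun=> 0%N) h x0) => p /=.
by rewrite expr0 mulr1.
Qed.

Lemma bdd_vwp (I : Type) x (g h : I -> nat) :
  bdd (fun p => vwp (x * q ^+ g p) q (h p)).
Proof.
have [K K0 hK] : bdd (fun p : nat * nat =>
    (1 - x * q ^+ p.1 * q ^+ (p.2 + p.2).+1) * qpoch (x * q ^+ p.1) q p.2).
  apply: bddM; last exact: bdd_qpoch_shift.
  apply: eq_bdd (bddD (bdd_cst _ 1) (bddM (bdd_cst _ (- x)) (bddM
    (bdd_comp fst (bdd_expr q1))
      (bdd_comp (fun p => (p.2 + p.2).+1) (bdd_expr q1))))) => p /=.
  by rewrite mulNr mulrA.
exists (K + 1); first by rewrite addr_ge0.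
move=> p; case: (h p) => [|k]; first by rewrite vwp0 normr1 lerDr.
by rewrite vwpS; apply: (le_trans (hK (g p, k))); rewrite lerDl.
Qed.

Lemma qpoch_qq_neq0 m : qpoch q q m != 0.
Proof.
elim: m => [|m IH]; rewrite ?qpoch0 ?oner_eq0 // qpochS mulf_neq0 //.
rewrite -exprS subr_eq0; apply/negP => /eqP e.
have : `|q ^+ m.+1| < 1 by rewrite normrX exprn_ilt1.
by rewrite -e normr1 ltxx.
Qed.

(** A bound uniform in the shift N, needed for the limit z q^N -> 0. *)
Lemma W65_bdd (B C D z : F) : (forall m, qpoch (C * D * z) q m != 0) ->
  (forall m, qpoch (B * D * z) q m != 0) ->
    (forall m, qpoch (B * C * z) q m != 0) ->
  exists2 K, 0 <= K & forall N m, `|W65_term q B C D (z * q ^+ N) m| <= K *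
    (`|z * q ^+ N|) ^+ m.
Proof.
move=> h1 h2 h3.
have [K K0 hK] : bdd (fun p : nat * nat =>
  vwp (B * C * D * z * q ^+ p.1) q p.2 *
    (qpoch B q p.2 * qpoch C q p.2 * qpoch D q p.2) *
  ((qpoch q q p.2)^-1 * (qpoch (C * D * z * q ^+ p.1) q p.2)^-1 *
   (qpoch (B * D * z * q ^+ p.1) q p.2)^-1 *
   (qpoch (B * C * z * q ^+ p.1) q p.2)^-1)).
  apply: bddM.
    by apply: bddM; [exact: bdd_vwp | do 2?apply: bddM; exact: bdd_qpoch].
  do 3?apply: bddM; [|exact: bdd_qpoch_inv_shift..].
  exact/bdd_qpoch_inv/qpoch_qq_neq0.
exists K => // N m; rewrite /W65_term !invfM -normrX normrM ler_wpM2r //.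
by have := hK (N, m); rewrite /= !mulrA.
Qed.

Lemma W65_sum_step (B C D z : F) : `|z| < 1 ->
  (forall m, qpoch (C * D * z) q m != 0) ->
  (forall m, qpoch (B * D * z) q m != 0) ->
    (forall m, qpoch (B * C * z) q m != 0) ->
  (1 - C * D * z) * (1 - B * D * z) * (1 - B * C * z) * (1 - z) *
    limn (series (W65_term q B C D z)) =
  (1 - B * C * D * z) * (1 - B * z) * (1 - C * z) * (1 - D * z) *
    limn (series (W65_term q B C D (z * q))).
Proof.
move=> z1 h1 h2 h3; have [L L0 hL] := W65_bdd h1 h2 h3.
have c0 : cvgn (series (W65_term q B C D z)).
  by apply: (FC (K := L) (r := `|z|)); rewrite ?normr_ge0 // => m;
    have := hL 0%N m; rewrite expr0 mulr1.
have zq1 : `|z * q| < 1 by rewrite normrM mulr_ilt1.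
have c1 : cvgn (series (W65_term q B C D (z * q))).
  by apply: (FC (K := L) (r := `|z * q|)); rewrite ?normr_ge0 // => m;
    have := hL 1%N m; rewrite expr1.
set u := W65_term q B C D z in c0 *; set v := W65_term q B C D (z * q) in c1 *.
set cu := (X in X * limn (series u)); set cv := (X in X * limn (series v)).
apply/eqP; rewrite -subr_eq0; apply/eqP.
pose x := B * C * D * z.
pose g m := - (qpoch x q m *
  (qpoch B q m.+1 * qpoch C q m.+1 * qpoch D q m.+1) *
      (1 - x * z * q ^+ m)) *
  ((qpoch q q m)^-1 * (qpoch (C * D * z * q) q m)^-1 *
    (qpoch (B * D * z * q) q m)^-1 *
   (qpoch (B * C * z * q) q m)^-1).
have uv m : cu * series u m.+1 - cv * series v m.+1 = g m * z ^+ m.+1.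
  rewrite /series /= !big_mkord !mulr_sumr -sumrB.
  rewrite (@W65_partial _ q B C D z m) //; last exact: qpoch_qq_neq0.
  by rewrite /g -/x !invfM; ring.
have n1 y : (forall m, qpoch y q m != 0) -> forall m, qpoch (y * q) q m != 0.
  by move=> h m; rewrite -[q in y * q]expr1; apply: qpoch_neq0_shift.
have [K' K'0 hg] : bdd g.
  apply: bddM.
    apply: eq_bdd (bddM (bdd_cst _ (-1))
      (bddM (bddM (bdd_qpoch x id) (bddM (bddM (bdd_qpoch B S)
      (bdd_qpoch C S)) (bdd_qpoch D S)))
        (bddD (bdd_cst _ 1) (bddM (bdd_cst _ (- (x * z))) (bdd_expr q1))))) =>
          m /=.
    by rewrite mulN1r mulNr.
  do 3?apply: bddM; apply: bdd_qpoch_inv; try exact: n1; exact: qpoch_qq_neq0.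
have lim1 : (fun m => cu * series u m.+1 - cv * series v m.+1) @ \oo -->
   cu * limn (series u) - cv * limn (series v).
  by apply: cvgB; apply: cvgMl_tmp; rewrite (cvg_shiftS (series _)).
have lim0 : (fun m => cu * series u m.+1 - cv * series v m.+1) @ \oo -->
  (0 : F).
  apply: (@cvg_dominated _ _ (fun m => K' * `|z| * `|z| ^+ m)).
    rewrite -[0](mulr0 (K' * `|z|)); apply: cvgMl_tmp; apply: (cvg_expr0 FC).
    by rewrite normr_ge0.
  by move=> m; rewrite subr0 uv normrM normrX -mulrA -exprS ler_wpM2r
    ?exprn_ge0.
exact: cvg_unique lim1 lim0.
Qed.

(** Iterating the contiguous relation multiplies the sum by finite products
and moves its argument to z q^N; as N grows these become infinite products and
the sum tends to its first term, which is 1. *)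
Lemma W65_sum (B C D z : F) : `|z| < 1 ->
  (forall m, qpoch (C * D * z) q m != 0) ->
  (forall m, qpoch (B * D * z) q m != 0) ->
    (forall m, qpoch (B * C * z) q m != 0) ->
  qpoch_inf (C * D * z) q * qpoch_inf (B * D * z) q * qpoch_inf (B * C * z) q *
    qpoch_inf z q * limn (series (W65_term q B C D z)) =
  qpoch_inf (B * C * D * z) q * qpoch_inf (B * z) q * qpoch_inf (C * z) q *
    qpoch_inf (D * z) q.
Proof.
move=> z1 h1 h2 h3; have [K K0 hK] := W65_bdd h1 h2 h3.
pose S N : F := limn (series (W65_term q B C D (z * q ^+ N))).
have zN N : `|z * q ^+ N| <= `|z|.
  by rewrite normrM ler_piMr // normrX exprn_ile1 // ltW.
have zN1 N : `|z * q ^+ N| < 1 := le_lt_trans (zN N) z1.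
have sh x N : (forall m, qpoch x q m != 0) ->
  forall m, qpoch (x * q ^+ N) q m != 0.
  by move=> h m; apply: qpoch_neq0_shift.
have step N : qpoch (C * D * z) q N * qpoch (B * D * z) q N *
  qpoch (B * C * z) q N *
    qpoch z q N * S 0%N =
  qpoch (B * C * D * z) q N * qpoch (B * z) q N * qpoch (C * z) q N *
    qpoch (D * z) q N * S N.
  elim: N => [|N IH]; first by rewrite !qpoch0 !mul1r.
  have e : (1 - C * D * (z * q ^+ N)) * (1 - B * D * (z * q ^+ N)) *
     (1 - B * C * (z * q ^+ N)) * (1 - z * q ^+ N) * S N =
     (1 - B * C * D * (z * q ^+ N)) * (1 - B * (z * q ^+ N)) *
       (1 - C * (z * q ^+ N)) *
     (1 - D * (z * q ^+ N)) * S N.+1.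
    rewrite /S (exprSr q) (mulrA z).
    by apply: W65_sum_step => // m; rewrite ?mulrA; apply: sh.
  rewrite !qpochS.
  transitivity ((1 - C * D * (z * q ^+ N)) * (1 - B * D * (z * q ^+ N)) *
     (1 - B * C * (z * q ^+ N)) * (1 - z * q ^+ N) *
     (qpoch (C * D * z) q N * qpoch (B * D * z) q N * qpoch (B * C * z) q N *
    qpoch z q N * S 0%N)); first by ring.
  rewrite IH.
  transitivity ((qpoch (B * C * D * z) q N * qpoch (B * z) q N *
    qpoch (C * z) q N *
    qpoch (D * z) q N) * ((1 - C * D * (z * q ^+ N)) *
      (1 - B * D * (z * q ^+ N)) *
     (1 - B * C * (z * q ^+ N)) * (1 - z * q ^+ N) * S N)); first by ring.
  by rewrite e; ring.
have S1 : S @ \oo --> (1 : F).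
  apply: (@cvg_dominated _ _ (fun N => K * `|z| / (1 - `|z|) * `|q| ^+ N)).
    rewrite -[0](mulr0 (K * `|z| / (1 - `|z|))); apply: cvgMl_tmp.
    by apply: (cvg_expr0 FC); rewrite normr_ge0.
  move=> N; have z01 : 0 <= `|z * q ^+ N| < 1 by rewrite normr_ge0 zN1.
  have := series_tail_le FC 1 z01 (hK N).
  rewrite {2}/series /= big_mkord big_ord1 /W65_term vwp0 !qpoch0 expr0 !mulr1
    invr1 mulr1 expr1.
  rewrite -/(S N) => h; apply: (le_trans h).
  rewrite [leLHS]mulrAC normrM normrX mulrA.
  apply: ler_wpM2r; first exact: exprn_ge0.
  rewrite [leRHS]mulrAC; apply: ler_wpM2r => //; apply: ler_wpM2l => //.
  by rewrite lef_pV2 ?posrE ?subr_gt0 -?normrX -?normrM ?lerD2l ?lerN2 //.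
have S0E : limn (series (W65_term q B C D z)) = S 0%N by rewrite /S expr0 mulr1.
rewrite S0E.
have L x : qpoch x q n @[n --> \oo] --> qpoch_inf x q by exact: cvg_qpoch.
have l1 : (fun N => qpoch (C * D * z) q N * qpoch (B * D * z) q N *
   qpoch (B * C * z) q N * qpoch z q N * S 0%N) @ \oo -->
   qpoch_inf (C * D * z) q * qpoch_inf (B * D * z) q * qpoch_inf (B * C * z) q *
    qpoch_inf z q * S 0%N.
  by apply: cvgMr_tmp; do 3?apply: cvgM; exact: L.
have l2 : (fun N => qpoch (C * D * z) q N * qpoch (B * D * z) q N *
   qpoch (B * C * z) q N * qpoch z q N * S 0%N) @ \oo -->
   qpoch_inf (B * C * D * z) q * qpoch_inf (B * z) q * qpoch_inf (C * z) q *
    qpoch_inf (D * z) q * 1.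
  by rewrite (funext step); apply: cvgM => //; do 3?apply: cvgM; exact: L.
by rewrite -[RHS]mulr1; exact: cvg_unique l1 l2.
Qed.

End Sum65.

(** * Askey-Wilson polynomials at degenerate parameters *)

Section Continuity.
Variable F : numFieldType.
Implicit Types (q z a b c d w : F) (n k : nat).

Lemma near_nbhs_neq a p : a != p -> \forall x \near nbhs a, x != p.
Proof.
rewrite -subr_eq0 -normr_gt0 => ap; exists `|a - p| => //= x /=.
by apply: contraTneq => ->; rewrite ltxx.
Qed.

Lemma near_neq a p : \forall x \near a^', x != p.
Proof.
have [<-|ap] := eqVneq a p; first exact: nbhs_dnbhs_neq.
apply: nbhs_dnbhs; exact: near_nbhs_neq.
Qed.

(** A shifted factorial whose argument is linear in the parameter has finitely
many zeros in it, so it does not vanish on a punctured neighbourhood, even at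
a parameter where it does vanish. *)
Lemma near_qpoch_neq0 q a w n : \forall x \near a^', qpoch (x * w) q n != 0.
Proof.
elim: n => [|n IH]; first by apply: nearW => x; rewrite qpoch0 oner_eq0.
near=> x; rewrite qpochS mulf_neq0 //; first by near: x.
have [wq0|wq0] := eqVneq (w * q ^+ n) 0;
  first by rewrite -mulrA wq0 mulr0 subr0 oner_eq0.
have : x != (w * q ^+ n)^-1 by near: x; exact: near_neq.
apply: contra => /eqP h; apply/eqP; apply: (mulIf wq0).
by rewrite mulVf // mulrA; apply/esym/eqP; rewrite -subr_eq0 h.
Unshelve. all: by end_near. Qed.

Section Cvg.
Variables (T : Type) (G : set_system T).
Context {FG : Filter G}.

Lemma cvg_qpoch_arg (f : T -> F) l q k : f x @[x --> G] --> l ->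
  qpoch (f x) q k @[x --> G] --> qpoch l q k.
Proof.
move=> fl; elim: k => [|k IH].
  by rewrite qpoch0; under eq_fun do rewrite qpoch0; exact: cvg_cst.
rewrite qpochS; under eq_fun do rewrite qpochS; apply: cvgM => //.
by apply: cvgB; [exact: cvg_cst|apply: cvgMr_tmp].
Qed.

Lemma cvg_vwp_arg (f : T -> F) l q k : f x @[x --> G] --> l ->
  vwp (f x) q k @[x --> G] --> vwp l q k.
Proof.
move=> fl; case: k => [|k]; first exact: cvg_cst.
rewrite vwpS; under eq_fun do rewrite vwpS; apply: cvgM;
  last exact: cvg_qpoch_arg.
by apply: cvgB; [exact: cvg_cst|apply: cvgMr_tmp].
Qed.

End Cvg.

Lemma cvg_aw_vwp q n z a b c d : qpoch q q n != 0 ->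
  qpoch (a * b) q n != 0 -> qpoch (a * c) q n != 0 -> qpoch (b * c) q n != 0 ->
  qpoch (a * b * c * z) q (n + n) != 0 ->
  aw_vwp q n z x b c d @[x --> a^'] --> aw_vwp q n z a b c d.
Proof.
move=> hq hab hac hbc hw; rewrite /aw_vwp.
have cx : x @[x --> a^'] --> a by exact: nbhs_dnbhs.
have cxM (w : F) : x * w @[x --> a^'] --> a * w by apply: cvgMr_tmp.
apply: cvgMl_tmp; apply: cvg_big => [|k _]; first exact: add_continuous.
have kn : (k <= n)%N by rewrite -ltnS.
have cw : x * b * c * z @[x --> a^'] --> a * b * c * z by do 2 apply: cvgMr_tmp.
have hk : qpoch (a * b * c * z) q (n + k) != 0 by apply: qpoch_neq0W hw;
  rewrite leq_add2l.
have hk1 := qpoch_neq0W kn hab; have hk2 := qpoch_neq0W kn hac.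
have hk3 := qpoch_neq0W kn hbc; have hk4 := qpoch_neq0W kn hq.
have hk5 := qpoch_neq0W (leq_subr k n) hq.
do 2 apply: cvgMr_tmp; apply: cvgM.
  apply: cvgM.
    apply: cvgM; first exact: cvg_vwp_arg.
    by do 2 apply: cvgMr_tmp; exact: cvg_qpoch_arg.
  apply: cvgV; first by rewrite !mulf_neq0.
  apply: cvgM; last exact: cvg_qpoch_arg.
  by apply: cvgMl_tmp; exact: cvg_qpoch_arg.
apply: cvgM.
  apply: cvgMr_tmp; apply: cvgMl_tmp; apply: cvg_qpoch_arg.
  by do 4 apply: cvgMr_tmp.
by apply: cvgV; [rewrite mulf_neq0|apply: cvgMl_tmp; exact: cvg_qpoch_arg].
Qed.

(** The 8W7 form has no denominator that vanishes when a = 0 or when ad is a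
power q^-j, hence it is continuous there and gives the value of the limit. *)
Lemma aw_at_vwp q n z a b c d :
  q != 0 -> z != 0 -> qpoch q q n != 0 -> qpoch (a * b) q n != 0 ->
  qpoch (a * c) q n != 0 -> qpoch (b * c) q n != 0 ->
  qpoch (a * b * c * z) q (n + n) != 0 ->
  aw_at q n z a b c d =
  qpoch (a * b) q n * qpoch (a * c) q n * qpoch (b * c) q n *
    aw_vwp q n z a b c d.
Proof.
move=> q0 z0 hq hab hac hbc hw; rewrite /aw_at; case: ifPn.
  move=> /andP[a0]; rewrite /qpochs !big_cons big_nil mulr1 !mulf_eq0 !negb_or.
  by move=> /and3P[_ _ had]; exact: aw_formula_vwp.
move=> _; apply/cvg_lim; first exact: norm_hausdorff.
apply: (@cvg_trans _ ((fun x =>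
  qpoch (x * b) q n * qpoch (x * c) q n * qpoch (b * c) q n *
   aw_vwp q n z x b c d) @ a^')).
  apply: near_eq_cvg; near=> x; apply/esym/aw_formula_vwp => //.
  - by near: x; exact: near_neq.
  - by near: x; exact: near_qpoch_neq0.
  - by near: x; exact: near_qpoch_neq0.
  - by near: x; exact: near_qpoch_neq0.
  - rewrite -!mulrA; near: x; exact: near_qpoch_neq0.
have cxM (w : F) : x * w @[x --> a^'] --> a * w.
  by apply: cvgMr_tmp; exact: nbhs_dnbhs.
apply: cvgM; last exact: cvg_aw_vwp.
by apply: cvgMr_tmp; apply: cvgM; apply: cvg_qpoch_arg.
Unshelve. all: by end_near. Qed.

End Continuity.

(** * The generating function as a double series *)

Section Generating.
Variable F : numFieldType.
Hypothesis FC : geom_complete F.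
Variables (q e a b c d r t : F).
Hypotheses (q0 : q != 0) (q1 : `|q| < 1) (e1 : `|e| = 1) (r0 : r != 0)
  (t0 : t != 0)
  (t1 : `|t| < 1).
Let X := a * b * c * d.
Let w := a * b * c * e.
Hypotheses (hab : forall n, qpoch (a * b) q n != 0)
  (hac : forall n, qpoch (a * c) q n != 0)
    (hbc : forall n, qpoch (b * c) q n != 0)
  (hXt : qpoch_inf (X * t / r) q != 0) (hrd : qpoch_inf (r * d) q != 0)
  (hw : qpoch_inf w q != 0) (hte : qpoch_inf (t * e) q != 0)
  (hwt : forall n, qpoch (a * b * c * t * e / r) q n != 0)
  (hre : forall n, qpoch (r * e) q n != 0).

Let e0 : e != 0. Proof. by rewrite -normr_eq0 e1 oner_eq0. Qed.

(** The n-th term of the generating function, after cancellation of (ab, ac,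
bc; q)_n, with (abcd; q)_(2n) / (abcd q^(n-1); q)_n written as [vwp]. *)
Definition gf_term n : F := vwp X q n / qpoch q q n * aw_vwp q n e a b c d *
  (qpoch (r / t) q n * qpoch (a * b * c / r) q n /
   (qpoch (X * t / r) q n * qpoch (r * d) q n)) * t ^+ n.

(** The double series whose diagonals are the terms of the generating function
and whose rows are 6W5 series. *)
Definition gf_double k m : F :=
  vwp w q k * (qpoch (a * e) q k * qpoch (b * e) q k * qpoch (c * e) q k *
    qpoch (r / t) q k * qpoch (a * b * c / r) q k) /
  (qpoch q q k * qpoch (b * c) q k * qpoch (a * c) q k * qpoch (a * b) q k *
   qpoch (X * t / r) q k * qpoch (r * d) q k) *
  (qpoch X q (k + k) / qpoch w q (k + k)) * (t / e) ^+ k *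
  W65_term q (r / t * q ^+ k) (a * b * c / r * q ^+ k) (d / e) (t * e) m.

(** The k-th term of the 8W7 on the right-hand side, with 1 - a1 cancelled. *)
Definition vwp87_term k : F :=
  vwp w q k * (qpoch (a * e) q k * qpoch (b * e) q k * qpoch (c * e) q k *
    qpoch (r / t) q k * qpoch (a * b * c / r) q k) /
  (qpoch q q k * qpoch (b * c) q k * qpoch (a * c) q k * qpoch (a * b) q k *
   qpoch (a * b * c * t * e / r) q k * qpoch (r * e) q k) * (t / e) ^+ k.

Let X0 := qpoch_inf_neq0 hXt.
Let rd0 := qpoch_inf_neq0 hrd.
Let w0 := qpoch_inf_neq0 hw.

Let eBCDz k : r / t * q ^+ k * (a * b * c / r * q ^+ k) * (d / e) * (t * e) =
  X * q ^+ (k + k).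
Proof. by rewrite /X exprD; field; rewrite r0 t0 e0. Qed.
Let eCDz k : a * b * c / r * q ^+ k * (d / e) * (t * e) = X * t / r * q ^+ k.
Proof. by rewrite /X; field; rewrite r0 e0. Qed.
Let eBDz k : r / t * q ^+ k * (d / e) * (t * e) = r * d * q ^+ k.
Proof. by field; rewrite t0 e0. Qed.
Let eBCz k : r / t * q ^+ k * (a * b * c / r * q ^+ k) * (t * e) = w * q ^+
  (k + k).
Proof. by rewrite /w exprD; field; rewrite r0 t0. Qed.

(** All shifted factorials and their inverses are bounded, so only the powers
of t matter; e has modulus 1. *)
Lemma gf_double_bdd : exists2 K, 0 <= K & forall k m, `|gf_double k m| <= K *
  `|t| ^+ (k + m).
Proof.
have [K K0 hK] : bdd (fun p : nat * nat =>
  vwp w q p.1 * (qpoch (a * e) q p.1 * qpoch (b * e) q p.1 *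
    qpoch (c * e) q p.1 *
    qpoch (r / t) q p.1 * qpoch (a * b * c / r) q p.1) *
  ((qpoch q q p.1)^-1 * (qpoch (b * c) q p.1)^-1 * (qpoch (a * c) q p.1)^-1 *
   (qpoch (a * b) q p.1)^-1 * (qpoch (X * t / r) q p.1)^-1 *
     (qpoch (r * d) q p.1)^-1) *
  (qpoch X q (p.1 + p.1) * (qpoch w q (p.1 + p.1))^-1) *
  (vwp (X * q ^+ (p.1 + p.1)) q p.2 *
   (qpoch (r / t * q ^+ p.1) q p.2 * qpoch (a * b * c / r * q ^+ p.1) q p.2 *
    qpoch (d / e) q p.2) *
   ((qpoch q q p.2)^-1 * (qpoch (X * t / r * q ^+ p.1) q p.2)^-1 *
    (qpoch (r * d * q ^+ p.1) q p.2)^-1 *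
      (qpoch (w * q ^+ (p.1 + p.1)) q p.2)^-1))).
  have vw : bdd (fun p : nat * nat => vwp w q p.1).
    apply: eq_bdd (bdd_vwp FC q1 w (fun=> 0%N) fst) => p /=;
      by rewrite expr0 mulr1.
  repeat apply: bddM => //; try exact: bdd_qpoch; try exact: bdd_vwp;
    try exact: bdd_qpoch_shift; try exact: bdd_qpoch_inv_shift;
    by apply: bdd_qpoch_inv => //; exact: qpoch_qq_neq0.
exists K => // k m; have := hK (k, m) => /=.
rewrite /gf_double /W65_term eBCDz eCDz eBDz eBCz.
have -> : `|t| ^+ (k + m) = `|(t / e) ^+ k * (t * e) ^+ m|.
  by rewrite normrM !normrX normrM normfV normrM e1 divr1 mulr1 exprD.
rewrite !invfM => h.
set u := (t / e) ^+ k; set v := (t * e) ^+ m.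
apply: (@le_trans _ _ (`| _ * (u * v)|)); last first.
  by rewrite normrM; apply: ler_wpM2r => //; exact: h.
by rewrite le_eqVlt; apply/orP; left; apply/eqP; congr (`| _ |); ring.
Qed.

Lemma gf_entry k m : let n := (k + m)%N in
  (vwp X q n / qpoch q q n * e ^+ n *
    (qpoch (r / t) q n * qpoch (a * b * c / r) q n /
   (qpoch (X * t / r) q n * qpoch (r * d) q n)) * t ^+ n) *
  (vwp w q k * (qpoch (a * e) q k * qpoch (b * e) q k * qpoch (c * e) q k) /
    (qpoch q q k * qpoch (b * c) q k * qpoch (a * c) q k * qpoch (a * b) q k) *
    (qpoch q q n * qpoch (X / q * q ^+ n) q k * qpoch (d / e) q m /
     (qpoch q q m * qpoch w q (n + k))) * e ^- k * e ^- k) = gf_double k m.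
Proof.
move=> n; rewrite /gf_double /W65_term eBCDz eCDz eBDz eBCz.
set A := (X in _ * e ^+ n * X * _); set B := (X in vwp w q k * X / _).
set D := (qpoch q q k * _ * _ * _).
transitivity ((vwp X q n * qpoch (X / q * q ^+ n) q k) *
  ((qpoch q q n)^-1 * e ^+ n * A * t ^+ n * (vwp w q k * B / D *
  (qpoch q q n * qpoch (d / e) q m / (qpoch q q m * qpoch w q (n + k))) * e ^-
    k * e ^- k))).
  by ring.
rewrite vwp_qpoch // /A /B /D.
have -> : (n + k = k + k + m)%N by rewrite /n addnAC.
have hq := qpoch_qq_neq0 q1.
have h1 x i j : (forall m, qpoch x q m != 0) -> qpoch (x * q ^+ i) q j != 0.
  by move=> h; apply: qpoch_neq0_shift.
have g1 := h1 _ k m X0; have g2 := h1 _ k m rd0; have g3 := h1 _ (k + k)%N m w0.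
have g4 := hq n; have g5 := hq k; have g6 := hq m.
have g7 := hbc k; have g8 := hac k; have g9 := hab k.
have g10 := w0 (k + k)%N; have g11 := X0 k; have g12 := rd0 k.
have ek : e ^+ k != 0 by rewrite expf_neq0.
have em : e ^+ m != 0 by rewrite expf_neq0.
rewrite expr_div_n exprMn /n !(exprD _ k m) -/n !(qpochD w q (k + k)).
rewrite /n (qpochD (r / t)) (qpochD (a * b * c / r)) (qpochD (X * t / r))
  (qpochD (r * d)) -/n.
move: g1 g2 g3 g4 g5 g6 g7 g8 g9 g10 g11 g12 ek em.
abstract_qpoch.
move: (e ^+ k) (e ^+ m) (t ^+ k) (t ^+ m) (vwp _ _ _) (vwp _ _ _).
move=> *; field.
by split_nonzero.
Qed.

Lemma gf_term_diagonal n : gf_term n = \sum_(k < n.+1) gf_double k (n - k).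
Proof.
pose A := vwp X q n / qpoch q q n * e ^+ n *
  (qpoch (r / t) q n * qpoch (a * b * c / r) q n /
   (qpoch (X * t / r) q n * qpoch (r * d) q n)) * t ^+ n.
rewrite /gf_term /aw_vwp -/w -/X.
transitivity (A * \sum_(k < n.+1)
    vwp w q k *
    (qpoch (a * e) q k * qpoch (b * e) q k * qpoch (c * e) q k) /
    (qpoch q q k * qpoch (b * c) q k * qpoch (a * c) q k * qpoch (a * b) q k) *
    (qpoch q q n * qpoch (X / q * q ^+ n) q k * qpoch (d / e) q (n - k) /
     (qpoch q q (n - k) * qpoch w q (n + k))) * e ^- k * e ^- k).
  by rewrite /A; move: (\sum_(k < n.+1) _) => S; ring.
rewrite mulr_sumr; apply: eq_bigr => k _.
have kn : (k <= n)%N by rewrite -ltnS.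
by have := gf_entry k (n - k); rewrite /= subnKC.
Qed.

(** Summing a row by the 6W5 sum leaves infinite products with arguments
shifted by q^k or q^(2k). Their ratios to the unshifted products are exactly
the factors that turn the coefficient of the row into a term of the 8W7. *)
Lemma gf_double_row k : limn (series (gf_double k)) =
  qpoch_inf X q * qpoch_inf (d * t) q * qpoch_inf (a * b * c * t * e / r) q *
   qpoch_inf (r * e) q / (qpoch_inf (X * t / r) q * qpoch_inf (r * d) q *
   qpoch_inf w q * qpoch_inf (t * e) q) * vwp87_term k.
Proof.
have te1 : `|t * e| < 1 by rewrite normrM e1 mulr1.
have h1 x i : (forall m, qpoch x q m != 0) ->
  forall j, qpoch (x * q ^+ i) q j != 0.
  by move=> h j; apply: qpoch_neq0_shift.
pose u := W65_term q (r / t * q ^+ k) (a * b * c / r * q ^+ k) (d / e) (t * e).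
have c1 : forall m, qpoch (a * b * c / r * q ^+ k * (d / e) * (t * e)) q m != 0.
  by rewrite eCDz; exact: h1.
have c2 : forall m, qpoch (r / t * q ^+ k * (d / e) * (t * e)) q m != 0.
  by rewrite eBDz; exact: h1.
have c3 : forall m, qpoch (r / t * q ^+ k * (a * b * c / r * q ^+ k) * (t * e))
  q m != 0.
  by rewrite eBCz; exact: h1.
have cu : cvgn (series u).
  have [K K0 hK] := W65_bdd FC q1 c1 c2 c3.
  apply: (FC (K := K) (r := `|t * e|)); rewrite ?normr_ge0 // => m.
  by have := hK 0%N m; rewrite expr0 mulr1.
have := W65_sum FC q1 te1 c1 c2 c3; rewrite -/u eBCDz eCDz eBDz eBCz.
have -> : r / t * q ^+ k * (t * e) = r * e * q ^+ k by field.
have -> : a * b * c / r * q ^+ k * (t * e) = a * b * c * t * e / r * q ^+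
  k by field.
have -> : d / e * (t * e) = d * t by field.
set S := limn (series u).
set H := vwp w q k * (qpoch (a * e) q k * qpoch (b * e) q k *
  qpoch (c * e) q k *
    qpoch (r / t) q k * qpoch (a * b * c / r) q k) /
  (qpoch q q k * qpoch (b * c) q k * qpoch (a * c) q k * qpoch (a * b) q k *
   qpoch (X * t / r) q k * qpoch (r * d) q k) *
  (qpoch X q (k + k) / qpoch w q (k + k)) * (t / e) ^+ k.
have -> : limn (series (gf_double k)) = H * S.
  apply/cvg_lim; first exact: norm_hausdorff.
  have -> : series (gf_double k) = (fun n => H * series u n).
    by apply: funext => n; rewrite /series /= mulr_sumr.
  exact: cvgMl_tmp.
rewrite /vwp87_term /H (qpoch_inf_shift FC q1 X (k + k))
  (qpoch_inf_shift FC q1 w (k + k)).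
rewrite (qpoch_inf_shift FC q1 (X * t / r) k) (qpoch_inf_shift FC q1 (r * d) k).
rewrite (qpoch_inf_shift FC q1 (r * e) k)
  (qpoch_inf_shift FC q1 (a * b * c * t * e / r) k).
move: hXt hrd hw hte.
rewrite (qpoch_inf_shift FC q1 (X * t / r) k) (qpoch_inf_shift FC q1 (r * d) k).
rewrite (qpoch_inf_shift FC q1 w (k + k)) !mulf_eq0 !negb_or.
move=> /andP[g1 g1'] /andP[g2 g2'] /andP[g3 g3'] g4 E.
have g5 := qpoch_qq_neq0 q1 k; have g6 := hbc k; have g7 := hac k;
  have g8 := hab k.
have g9 := hwt k; have g10 := hre k.
have -> : S = qpoch_inf (X * q ^+ (k + k)) q * qpoch_inf (r * e * q ^+ k) q *
   qpoch_inf (a * b * c * t * e / r * q ^+ k) q * qpoch_inf (d * t) q /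
  (qpoch_inf (X * t / r * q ^+ k) q * qpoch_inf (r * d * q ^+ k) q *
   qpoch_inf (w * q ^+ (k + k)) q * qpoch_inf (t * e) q).
  by rewrite -E; field; rewrite g1' g2' g3' g4.
move: g1 g1' g2 g2' g3 g3' g4 g5 g6 g7 g8 g9 g10 {E}.
abstract_qpoch.
repeat match goal with |- context [qpoch_inf ?x ?y] => move: (qpoch_inf x y) =>
  ? end.
move: ((t / e) ^+ k) (vwp _ _ _).
move=> *; field.
by split_nonzero.
Qed.

Lemma cvg_vwp87 : cvgn (series vwp87_term).
Proof.
have [K K0 hK] : bdd (fun k : nat =>
  vwp w q k * (qpoch (a * e) q k * qpoch (b * e) q k * qpoch (c * e) q k *
    qpoch (r / t) q k * qpoch (a * b * c / r) q k) *
  ((qpoch q q k)^-1 * (qpoch (b * c) q k)^-1 * (qpoch (a * c) q k)^-1 *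
   (qpoch (a * b) q k)^-1 * (qpoch (a * b * c * t * e / r) q k)^-1 *
     (qpoch (r * e) q k)^-1)).
  have vw : bdd (fun k => vwp w q k).
    apply: eq_bdd (bdd_vwp FC q1 w (fun=> 0%N) id) => p /=;
      by rewrite expr0 mulr1.
  repeat apply: bddM => //; try exact: bdd_qpoch;
    by apply: bdd_qpoch_inv => //; exact: qpoch_qq_neq0.
apply: (FC (K := K) (r := `|t|)); rewrite ?normr_ge0 // => k.
have -> : `|t| ^+ k = `|(t / e) ^+ k| by rewrite normrX normrM normfV e1 divr1.
rewrite /vwp87_term !invfM normrM.
by apply: ler_wpM2r; [exact: normr_ge0|exact: hK].
Qed.

Lemma gf_cvg : series gf_term @ \oo -->
  qpoch_inf X q * qpoch_inf (d * t) q * qpoch_inf (a * b * c * t * e / r) q *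
   qpoch_inf (r * e) q / (qpoch_inf (X * t / r) q * qpoch_inf (r * d) q *
   qpoch_inf w q * qpoch_inf (t * e) q) * limn (series vwp87_term).
Proof.
have [K K0 hK] := gf_double_bdd.
rewrite (funext gf_term_diagonal); apply: (series_diagonal FC _ hK).
  by rewrite normr_ge0.
rewrite (funext gf_double_row); set c0 := _ / _.
have -> : series (fun k => c0 * vwp87_term k) =
  (fun n => c0 * series vwp87_term n).
  by apply: funext => n; rewrite /series /= mulr_sumr.
by apply: cvgMl_tmp; exact: cvg_vwp87.
Qed.

End Generating.

(** * Completeness of the complex numbers *)

Section ComplexComplete.
Variable R : realType.

Lemma normc_real (k : R) : `|k%:C%C| = `|k|%:C%C :> R[i]%C.
Proof. by rewrite normc_def /= expr0n addr0 sqrtr_sqr. Qed.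

Lemma normc_ge_Im (x : R[i]%C) : (`|complex.Im x|%:C)%C <= `|x|.
Proof.
have := normc_ge_Re (x * 'i%C); rewrite ReiNIm normrN normrM.
have -> : `|'i%C : R[i]%C| = 1 by rewrite normc_def /=
  expr0n expr1n add0r sqrtr1.
by rewrite mulr1.
Qed.

Lemma normc_le_ReIm (x : R[i]%C) :
  `|x| <= ((`|complex.Re x| + `|complex.Im x|)%:C)%C.
Proof.
rewrite [in leLHS](complexE x); apply: (le_trans (ler_normD _ _)).
rewrite normrM !normc_real.
have -> : `|'i%C : R[i]%C| = 1 by rewrite normc_def /=
  expr0n expr1n add0r sqrtr1.
by rewrite mul1r rmorphD.
Qed.

(** Real and imaginary parts are dominated by the same geometric series. *)
Lemma Cplx_geom_complete : geom_complete (Cplx R).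
Proof.
move=> u K r /andP[r0 r1] uK.
pose ru n : R := complex.Re (u n : R[i]%C);
  pose iu n : R := complex.Im (u n : R[i]%C).
have K0 : 0 <= K by have := uK 0%N; rewrite expr0 mulr1; apply: le_trans.
have [K' eK] : exists K', K = K'%:C%C by apply/complex_realP/ger0_real.
have [r' er] : exists r', r = r'%:C%C by apply/complex_realP/ger0_real.
move: r0 r1 K0 uK; rewrite eK er => r0 r1 K0 uK.
have r'0 : 0 <= r' by rewrite -ler0c.
have r'1 : r' < 1 by rewrite -ltcR.
have K'0 : 0 <= K' by rewrite -ler0c.
have uK' n : `|u n| <= (K' * r' ^+ n)%:C%C by rewrite rmorphM rmorphXn;
  exact: uK.
have gc : cvgn (series (fun n => K' * r' ^+ n)).
  by apply: is_cvg_geometric_series; rewrite ger0_norm.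
have cr : cvgn (series ru).
  apply: (@normed_cvg R R^o); apply: series_le_cvg gc => n /=;
    [exact: normr_ge0|by rewrite mulr_ge0 ?exprn_ge0|].
  by rewrite -lecR; apply: le_trans (uK' n); exact: normc_ge_Re.
have ci : cvgn (series iu).
  apply: (@normed_cvg R R^o); apply: series_le_cvg gc => n /=;
    [exact: normr_ge0|by rewrite mulr_ge0 ?exprn_ge0|].
  by rewrite -lecR; apply: le_trans (uK' n); exact: normc_ge_Im.
pose L : Cplx R := (limn (series ru) +i* limn (series iu))%C.
have sE n : (series u n : R[i]%C) = (series ru n +i* series iu n)%C.
  rewrite /series /= !big_mkord; elim: n => [|n IH]; first by rewrite !big_ord0.
  by rewrite !big_ord_recr /= IH /ru /iu; case: (u n).
apply/cvg_ex; exists L; apply/cvgrPdist_lt => eps eps0.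
have [e' ee] : exists e', eps = e'%:C%C by apply/complex_realP/ger0_real/ltW.
move: eps0; rewrite ee => e0.
have e'0 : 0 < e' / 2 by rewrite divr_gt0 // -ltcR.
move/cvgrPdist_lt : cr => /(_ _ e'0) cr.
move/cvgrPdist_lt : ci => /(_ _ e'0) ci.
near=> n; apply: (le_lt_trans (normc_le_ReIm _)).
rewrite sE /L /= ltcR [ltRHS]splitr; apply: ltrD.
  by near: n; exact: cr.
by near: n; exact: ci.
Unshelve. all: by end_near. Qed.

End ComplexComplete.

(** * The generating function *)

Section Final.
Variable F : numFieldType.

(** The comparison with the textbook form of the very-well-poised factor,
which divides by 1 - x / q. *)
Lemma vwp_div (x q : F) k : q != 0 -> 1 - x / q != 0 ->
  vwp x q k = (1 - x / q * q ^+ (2 * k)) / (1 - x / q) * qpoch (x / q) q k.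
Proof.
move=> q0 x1; case: k => [|k];
  first by rewrite muln0 expr0 mulr1 qpoch0 mulr1 divff.
rewrite qpochSl vwpS (divfK q0) mulrA (divfK x1); congr (_ * _); congr (1 - _).
by rewrite mul2n -addnn addSn addnS [in RHS]exprS mulrA (divfK q0).
Qed.

Lemma W87_termE (q e a b c r t : F) k : q != 0 -> e != 0 -> r != 0 -> t != 0 ->
  1 - a * b * c * e / q != 0 ->
  W87_term q (a * b * c * e / q) [:: (a * e, b * c); (b * e, a * c);
    (c * e, a * b);
    (r / t, a * b * c * t * e / r); (a * b * c / r, r * e)] (t / e) k =
  vwp87_term q e a b c r t k.
Proof.
move=> q0 e0 r0 t0 a10; rewrite /W87_term /W87_den /vwp87_term /=.
have l x y : (x != 0 -> a * b * c * e = y * x) ->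
    wp_lower q (a * b * c * e / q) (x, y) = y.
  rewrite /wp_lower /= => h; case: ifP => // x0.
  by rewrite divfK // (h x0) mulfK.
rewrite !l /qpochs ?big_cons ?big_nil ?vwp_div //; first last.
- by move=> _; ring.
- by move=> _; ring.
- by move=> _; ring.
- by move=> _; field; rewrite ?r0 ?t0.
- by move=> _; field; rewrite ?r0 ?t0.
rewrite !mulr1 -!mulrA; congr (_ * (_ * _)).
Qed.

(** The theorem for an arbitrary field in which geometrically dominated series
converge, and for any e of modulus 1. *)
Lemma generating_function (FC : geom_complete F) (q e a b c d r t : F) :
  q != 0 -> `|q| < 1 -> `|e| = 1 -> r != 0 -> t != 0 -> `|t| < 1 ->
  let a1 := a * b * c * e / q in
  let p4 := (a * e, b * c) in
  let p5 := (b * e, a * c) in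
  let p6 := (c * e, a * b) in
  let p7 := (r / t, a * b * c * t * e / r) in
  let p8 := (a * b * c / r, r * e) in
  (forall n : nat,
     qpochs [:: q; a * b; a * c; b * c; a * b * c * d * q ^ (n%:Z - 1)] q n
       != 0) ->
  qpochs_inf [:: a * b * c * d * t / r; d * r; a * b * c * e; t * e] q != 0 ->
  1 - a1 != 0 ->
  (forall k : nat, W87_den q a1 [:: p4; p5; p6; p7; p8] k != 0) ->
  cvgn (series (W87_term q a1 [:: p4; p5; p6; p7; p8] (t / e))) /\
  series (fun n : nat =>
    qpoch (a * b * c * d) q (2 * n) * aw_at q n e a b c d /
      qpochs [:: q; a * b; a * c; b * c; a * b * c * d * q ^ (n%:Z - 1)] q n *
    (qpochs [:: r / t; a * b * c / r] q n /
      qpochs [:: a * b * c * d * t / r; r * d] q n) * t ^+ n) @ \oo -->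
  qpochs_inf [:: a * b * c * d; d * t; a * b * c * t * e / r; r * e] q /
    qpochs_inf [:: a * b * c * d * t / r; d * r; a * b * c * e; t * e] q *
  W87 q a1 p4 p5 p6 p7 p8 (t / e).
Proof.
move=> q0 q1 e1 r0 t0 t1 a1 p4 p5 p6 p7 p8 hL hI ha1 hW.
have e0 : e != 0 by rewrite -normr_eq0 e1 oner_eq0.
have [hab hac hbc hX] : [/\ forall n, qpoch (a * b) q n != 0, forall n,
  qpoch (a * c) q n != 0,
    forall n, qpoch (b * c) q n != 0 &
    forall n, qpoch (a * b * c * d / q * q ^+ n) q n != 0].
  split => n; have := hL n; rewrite /qpochs !big_cons big_nil !mulf_eq0
    !negb_or;
    rewrite expfzDr // exprN1 => /and5P[? ? ? ? /andP[+ _]] //.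
  by rewrite mulrCA mulrC.
move: hI; rewrite {1}/qpochs_inf !big_cons big_nil mulr1 !mulf_eq0 !negb_or.
rewrite [d * r]mulrC => /and4P[hXt hrd hw hte].
have lE x y : (x != 0 -> a * b * c * e = y * x) -> wp_lower q a1 (x, y) = y.
  rewrite /wp_lower /= /a1 => h; case: ifP => // x0.
  by rewrite divfK // (h x0) mulfK.
have [hwt hre] : (forall n, qpoch (a * b * c * t * e / r) q n != 0) /\
    (forall n, qpoch (r * e) q n != 0).
  split=> n; have := hW n; rewrite /W87_den /qpochs !big_cons big_nil.
    rewrite (lE _ (a * b * c * t * e / r)); last by move=> _; field;
      rewrite ?r0 ?t0.
    by rewrite !mulf_eq0 !negb_or => /and5P[_ _ _ _ /and3P[]].
  rewrite (lE _ (r * e)); last by move=> _; field; rewrite ?r0 ?t0.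
  by rewrite !mulf_eq0 !negb_or => /and5P[_ _ _ _ /and3P[]].
have wE : W87_term q a1 [:: p4; p5; p6; p7; p8] (t / e) =
  vwp87_term q e a b c r t.
  by apply: funext => k; exact: W87_termE.
rewrite /W87 wE; split; first exact: cvg_vwp87.
have w0 := qpoch_inf_neq0 hw.
have tE n : qpoch (a * b * c * d) q (2 * n) * aw_at q n e a b c d /
      qpochs [:: q; a * b; a * c; b * c; a * b * c * d * q ^ (n%:Z - 1)] q n *
    (qpochs [:: r / t; a * b * c / r] q n /
      qpochs [:: a * b * c * d * t / r; r * d] q n) * t ^+ n =
        gf_term q e a b c d r t n.
  have hq := qpoch_qq_neq0 q1 n.
  rewrite aw_at_vwp // /gf_term /qpochs !big_cons !big_nil expfzDr //
    exprN1 !mulr1.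
  have -> : a * b * c * d * (q ^ n * q^-1) = a * b * c * d / q * q ^+
    n by rewrite mulrCA mulrC.
  have := vwp_qpoch (a * b * c * d) n 0 q0;
    rewrite addn0 vwp0 mulr1 addnn -mul2n => <-.
  have hXn := hX n; have habn := hab n; have hacn := hac n; have hbcn := hbc n.
  have xt := qpoch_inf_neq0 hXt n; have rd := qpoch_inf_neq0 hrd n.
  move: hq hXn habn hacn hbcn xt rd.
  abstract_qpoch.
  move: (vwp _ _ _) (aw_vwp _ _ _ _ _ _ _) (t ^+ n).
  move=> *; field.
  by split_nonzero.
rewrite (funext tE) /qpochs_inf !big_cons !big_nil !mulr1 !mulrA.
exact: gf_cvg.
Qed.

End Final.

Theorem theorem2p1 (R : realType) (q0 : R) (a b c d r t : Cplx R) (theta : R) :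
  let q : Cplx R := ofR q0 in
  let e : Cplx R := expi theta in
  let e' : Cplx R := expi (- theta) in
  let a1 := a * b * c * e / q in
  let p4 := (a * e, b * c) in
  let p5 := (b * e, a * c) in
  let p6 := (c * e, a * b) in
  let p7 := (r / t, a * b * c * t * e / r) in
  let p8 := (a * b * c / r, r * e) in
  0 < q0 < 1 -> r != 0 -> t != 0 ->
  (forall n : nat,
     qpochs [:: q; a * b; a * c; b * c; a * b * c * d * q ^ (n%:Z - 1)] q n
       != 0) ->
  (forall n : nat, qpochs [:: a * b * c * d * t / r; r * d] q n != 0) ->
  qpochs_inf [:: a * b * c * d * t / r; d * r; a * b * c * e; t * e] q != 0 ->
  1 - a1 != 0 ->
  (forall k : nat, W87_den q a1 [:: p4; p5; p6; p7; p8] k != 0) ->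
  `|t| < 1 ->
  cvgn (series (W87_term q a1 [:: p4; p5; p6; p7; p8] (t * e'))) /\
  series (fun n : nat =>
    qpoch (a * b * c * d) q (2 * n) * askey_wilson_cos q n theta a b c d /
      qpochs [:: q; a * b; a * c; b * c; a * b * c * d * q ^ (n%:Z - 1)] q n *
    (qpochs [:: r / t; a * b * c / r] q n /
      qpochs [:: a * b * c * d * t / r; r * d] q n) * t ^+ n) @ \oo -->
  qpochs_inf [:: a * b * c * d; d * t; a * b * c * t * e / r; r * e] q /
    qpochs_inf [:: a * b * c * d * t / r; d * r; a * b * c * e; t * e] q *
  W87 q a1 p4 p5 p6 p7 p8 (t * e').
Proof.
move=> q e e' a1 p4 p5 p6 p7 p8 /andP[q00 q01] r0 t0 hL hR hI ha1 hW t1.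
have FC := @Cplx_geom_complete R.
have nq : `|q| = (`|q0|%:C)%C :> Cplx R by exact: normc_real.
have q1 : `|q| < 1 by rewrite nq gtr0_norm // ltcR.
have qn0 : q != 0 by rewrite -normr_gt0 nq gtr0_norm // ltcR.
have e1 : `|e| = 1.
  by rewrite /e /expi [LHS]normc_def /= cos2Dsin2 sqrtr1.
have e0 : e != 0 by rewrite -normr_eq0 e1 oner_eq0.
have ee : e' = e^-1.
  apply: (mulfI e0); rewrite mulfV // /e /e' /expi cosN sinN.
  apply/eqP; rewrite eq_complex /=; apply/andP; split; apply/eqP.
    by rewrite mulrN opprK -!expr2 cos2Dsin2.
  by rewrite mulrN mulrC addNr.
rewrite ee; exact: generating_function.
Qed.
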